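(* Let $p$ be any positive integer. If the initial data $u_0$ is an analytic function on $\mathbb{T}$, then there exist an $\varepsilon>0$ and a unique solution $u$ of the Cauchy problem $$\partial_t u+u^p\,\partial_x u=\tfrac12\,\partial_x^{-1}\big(\partial_x(u^p)\,\partial_x u\big),\qquad u(x,0)=u_0(x),$$ that is analytic in both variables $x$ and $t$ on $\mathbb{T}$ for all $t$ in $(-\varepsilon,\varepsilon)$.
   Context: $\mathbb{T}\simeq\mathbb{R}/\mathbb{Z}$ is the circle, $x\in\mathbb{T}$ is the space variable and $t\in\mathbb{R}$ the time variable. The equation is the modified Hunter-Saxton equation, written in nonlocal form. The operator $\partial_x^{-1}$ is defined, for some fixed $x_0\in\mathbb{T}$, by $$\partial_x^{-1}f(x):=\int_{x_0}^{x}f(y)\,dy-\int_{\mathbb{T}}\int_{x_0}^{z}f(y)\,dy\,dz.$$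
   Formalization: The operator ∂_x^{-1} is applied to ∂_x(u^p)∂_x u minus its mean over T, since the given formula defines a function on T only for mean-zero arguments; as written, no solution exists e.g. for p=1, u_0=sin(2πx). *)

(* Defs.v *)
(* Stdlib reals with Coquelicot *)
From Stdlib Require Import Reals.
From Coquelicot Require Import Coquelicot.
Open Scope R_scope.

(* Functions on the circle R/Z are represented by 1-periodic functions on R. *)
Definition periodic1 (f : R -> R) : Prop :=
  forall x : R, f (x + 1) = f x.

Definition analytic_at (f : R -> R) (x : R) : Prop :=
  exists (a : nat -> R) (r : R),
    0 < r /\
    forall h : R, Rabs h < r -> is_pseries a h (f (x + h)).

(* Joint real analyticity: near (x, t), [u] is the sum of an absolutely
   convergent double power series, the terms being grouped by total degree. *)
Definition analytic2_at (u : R -> R -> R) (x t : R) : Prop :=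
  exists (a : nat -> nat -> R) (r : R),
    0 < r /\
    forall h k : R, Rabs h < r -> Rabs k < r ->
      ex_series (fun n : nat =>
        sum_f_R0 (fun i : nat => Rabs (a i (n - i)%nat * h ^ i * k ^ (n - i))) n) /\
      is_series (fun n : nat =>
        sum_f_R0 (fun i : nat => a i (n - i)%nat * h ^ i * k ^ (n - i)) n)
        (u (x + h) (t + k)).

Definition circle_int (f : R -> R) : R := RInt f 0 1.

Definition dx_inv (x0 : R) (f : R -> R) (x : R) : R :=
  RInt f x0 x - circle_int (fun z : R => RInt f x0 z).

Definition mean_zero_part (f : R -> R) (x : R) : R := f x - circle_int f.

(* [dx_inv x0 f] descends to the circle only if [f] has mean zero: its values
   at x + 1 and x differ by [circle_int f].  The source
   d_x(u^p) d_x u = p u^(p-1) (d_x u)^2 need not have mean zero, whereas the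
   left-hand side is periodic, so the inverse of d_x on the circle is applied to
   the mean-zero part of the source, i.e. the zero Fourier mode is sent to 0. *)
Definition solves_mHS (x0 : R) (p : nat) (eps : R) (u : R -> R -> R) : Prop :=
  forall x t : R, Rabs t < eps ->
    Derive (fun s : R => u x s) t + u x t ^ p * Derive (fun y : R => u y t) x
    = / 2 * dx_inv x0
              (mean_zero_part (fun y : R =>
                 Derive (fun z : R => u z t ^ p) y * Derive (fun z : R => u z t) y))
              x.

(* Only the values [u x t] with |t| < eps matter. *)
Definition analytic_solution (x0 : R) (p : nat) (u0 : R -> R) (eps : R)
    (u : R -> R -> R) : Prop :=
  (forall t : R, Rabs t < eps -> periodic1 (fun x : R => u x t)) /\
  (forall x t : R, Rabs t < eps -> analytic2_at u x t) /\
  solves_mHS x0 p eps u /\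
  (forall x : R, u x 0 = u0 x).

(* Main.v *)
Require Import Defs.
From Stdlib Require Import Reals Lra Lia Psatz Arith ZArith FunctionalExtensionality ClassicalEpsilon.
From Coquelicot Require Import Coquelicot.
Open Scope R_scope.

(** The proof is that of the Cauchy-Kovalevskaya theorem: the solution is built as
a power series in t whose coefficients are functions of x, majorised
explicitly, and uniqueness holds because the equation determines these
coefficients.

A function u is represented by its jets [a n k x], the coefficients of t^n h^k
in the expansion of u (x + h, t). Products, x-derivatives and the nonlocal
operator all act on jets ([conv], [Dx], [Dinv]). The operator [Dinv] is harmless:
[dx_inv] of the mean-zero part of f is the periodic primitive of f minus its
mean that has mean zero itself ([dx_inv_unique]), its sup norm is at most twice
that of f, and its x-derivative is f minus its mean.

Existence. The equation becomes a recursion giving the coefficient of t^(n+1)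
from those of order at most n; [picard_limit] solves it. Convergence comes from
a majorant in the variable z = Q h + l t. Let Phi and Psi be the series with
coefficients 1/(N+1)^3 and 1/(N+1)^2. If u is majorised by a multiple of Phi z
then its x-derivative is majorised by a multiple of Psi z, and Psi^2 is below
8 Psi ([majorized_conv]), so the whole right-hand side is below a multiple e
of Psi z, with e independent of l ([majorized_rhs_jets]). Integrating in time
turns Psi back into Phi at the price of a factor of order e / l
([majorized_integrate]), and a large l closes the induction
([picard_limit_good]). The sums of the resulting jets solve the equation
([recursive_solves]) and are jointly analytic ([good_analytic2]); both
facts are exchanges of absolutely convergent double series.

Uniqueness. The double power series of an analytic solution v at the points
(x, 0) are jets with bounds uniform in x, by compactness of the circle
([analytic2_jets]). For small t the equation for v is an identity between power
series in t, so these jets satisfy the same recursion ([solves_recursive]) with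
the same initial value, and coincide with those of u ([recursive_unique]). Thus
v = u for small t, and for each x the identity theorem in t extends the equality
to the whole interval ([identity_theorem]). The initial datum enters through the
same lemma [analytic2_jets], applied to u0 seen as a function independent of t. *)

(** * Finite sums and double series *)

Lemma sum_swap (F : nat -> nat -> R) (n m : nat) :
  sum_f_R0 (fun i => sum_f_R0 (F i) m) n =
  sum_f_R0 (fun j => sum_f_R0 (fun i => F i j) n) m.
Proof.
  induction n as [|n IH]; simpl.
  - reflexivity.
  - rewrite IH, <- plus_sum. reflexivity.
Qed.

Lemma sum_first (F : nat -> R) (n : nat) :
  sum_f_R0 F (S n) = F 0%nat + sum_f_R0 (fun i => F (S i)) n.
Proof. rewrite decomp_sum by lia. reflexivity. Qed.

Lemma term_le_sum (F : nat -> R) (N i : nat) :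
  (forall m, 0 <= F m) -> (i <= N)%nat -> F i <= sum_f_R0 F N.
Proof.
  intros HF. induction N as [|N IH]; intros Hi.
  - replace i with 0%nat by lia. apply Rle_refl.
  - rewrite tech5. destruct (Nat.eq_dec i (S N)) as [->|Hne].
    + pose proof (cond_pos_sum F N HF). lra.
    + specialize (IH ltac:(lia)). pose proof (HF (S N)). lra.
Qed.

Lemma ex_series_nonneg_bounded (g : nat -> R) (B : R) :
  (forall n, 0 <= g n) -> (forall N, sum_f_R0 g N <= B) -> ex_series g.
Proof.
  intros H0 HB.
  destruct (ex_finite_lim_seq_incr (sum_n g) B) as [l Hl].
  - intros n. rewrite sum_Sn. specialize (H0 (S n)).
    change (sum_n g n <= sum_n g n + g (S n)). lra.
  - intros n. rewrite sum_n_Reals. apply HB.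
  - exists l. exact Hl.
Qed.

Lemma sum_le_Series (g : nat -> R) (N : nat) :
  (forall n, 0 <= g n) -> ex_series g -> sum_f_R0 g N <= Series g.
Proof.
  intros H0 Hg.
  apply sum_incr; [|exact H0].
  apply is_lim_seq_Reals.
  apply is_lim_seq_ext with (sum_n g).
  - intros n. apply sum_n_Reals.
  - apply Series_correct. exact Hg.
Qed.

Lemma term_le_Series (g : nat -> R) (N : nat) :
  (forall n, 0 <= g n) -> ex_series g -> g N <= Series g.
Proof.
  intros H0 Hg. apply Rle_trans with (sum_f_R0 g N).
  - apply term_le_sum; [exact H0|lia].
  - apply sum_le_Series; assumption.
Qed.

Lemma ex_series_dom (f g : nat -> R) :
  (forall n, Rabs (f n) <= g n) -> ex_series g -> ex_series f.
Proof. intros H Hg. apply (ex_series_le f g); assumption. Qed.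

Lemma ex_series_dom_abs (f g : nat -> R) :
  (forall n, Rabs (f n) <= g n) -> ex_series g -> ex_series (fun n => Rabs (f n)).
Proof.
  intros H Hg. apply (ex_series_dom _ g); [|exact Hg].
  intros n. rewrite Rabs_Rabsolu. apply H.
Qed.

Lemma Series_abs_le (f g : nat -> R) :
  (forall n, Rabs (f n) <= g n) -> ex_series g -> Rabs (Series f) <= Series g.
Proof.
  intros H Hg. apply Rle_trans with (Series (fun n => Rabs (f n))).
  - apply Series_Rabs. exact (ex_series_dom_abs f g H Hg).
  - apply Series_le; [|exact Hg]. intros n. split; [apply Rabs_pos|apply H].
Qed.

Lemma Series_nonneg (f : nat -> R) :
  (forall n, 0 <= f n) -> ex_series f -> 0 <= Series f.
Proof.
  intros H Hf. apply Rle_trans with (f 0%nat); [apply H|].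
  apply term_le_Series; assumption.
Qed.

Lemma is_series_sum (F : nat -> nat -> R) (N : nat) :
  (forall i, ex_series (F i)) ->
  is_series (fun j => sum_f_R0 (fun i => F i j) N) (sum_f_R0 (fun i => Series (F i)) N).
Proof.
  intros H. induction N as [|N IH]; simpl.
  - apply Series_correct, H.
  - apply (is_series_plus _ _ _ _ IH). apply Series_correct, H.
Qed.

(** Tannery's theorem: the tail of g controls the tails of all the [f N] at
    once, and the remaining finite sums converge term by term. *)
Lemma dominated_series (f : nat -> nat -> R) (f0 g : nat -> R) :
  (forall N j, Rabs (f N j) <= g j) -> ex_series g ->
  (forall j, is_lim_seq (fun N => f N j) (f0 j)) ->
  is_lim_seq (fun N => Series (f N)) (Series f0).
Proof.
  intros Hd Hg Hl.
  assert (Hd0 : forall j, Rabs (f0 j) <= g j).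
  { intros j.
    pose proof (is_lim_seq_abs _ _ (Hl j)) as Ha.
    exact (is_lim_seq_le _ (fun _ => g j) (Rabs (f0 j)) (g j)
             (fun N => Hd N j) Ha (is_lim_seq_const (g j))). }
  assert (Hgpos : forall j, 0 <= g j).
  { intros j. apply Rle_trans with (Rabs (f0 j)); [apply Rabs_pos|apply Hd0]. }
  apply is_lim_seq_spec. intros e.
  assert (Hs : is_lim_seq (sum_n g) (Series g)) by exact (Series_correct _ Hg).
  assert (He4 : 0 < e / 4) by (destruct e; simpl; lra).
  apply is_lim_seq_spec in Hs. specialize (Hs (mkposreal _ He4)).
  destruct Hs as [J HJ]. specialize (HJ J (Nat.le_refl _)). simpl in HJ.
  rewrite sum_n_Reals in HJ.
  assert (Htail : Series (fun k => g (S J + k)%nat) < e / 4).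
  { pose proof (Series_incr_n g (S J) ltac:(lia) Hg) as H. simpl pred in H.
    apply Rabs_def2 in HJ. lra. }
  assert (Hgt : ex_series (fun k => g (S J + k)%nat)).
  { apply (ex_series_incr_n g (S J)). exact Hg. }
  assert (Hlf : is_lim_seq (fun N => sum_f_R0 (f N) J) (sum_f_R0 f0 J)).
  { clear HJ Htail Hgt. induction J as [|J IH]; simpl.
    - apply Hl.
    - apply is_lim_seq_plus'; [exact IH|apply Hl]. }
  apply is_lim_seq_spec in Hlf. specialize (Hlf (mkposreal _ He4)).
  destruct Hlf as [N0 HN0]. exists N0. intros N HN.
  specialize (HN0 N HN). simpl in HN0.
  assert (Hex : ex_series (f N)) by (apply (ex_series_dom _ g); [apply Hd|exact Hg]).
  assert (Hex0 : ex_series f0) by (apply (ex_series_dom _ g); [apply Hd0|exact Hg]).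
  rewrite (Series_incr_n (f N) (S J) ltac:(lia) Hex).
  rewrite (Series_incr_n f0 (S J) ltac:(lia) Hex0). simpl pred.
  pose proof (Series_abs_le (fun k => f N (S J + k)%nat) _ (fun k => Hd N (S J + k)%nat) Hgt) as H1.
  pose proof (Series_abs_le (fun k => f0 (S J + k)%nat) _ (fun k => Hd0 (S J + k)%nat) Hgt) as H2.
  apply Rabs_def2 in HN0. apply Rabs_le_between in H1. apply Rabs_le_between in H2.
  apply Rabs_def1; lra.
Qed.

(** Absolute summability in terms of iterated sums, the form in which double
    power series appear below. *)
Definition summable2 (a : nat -> nat -> R) : Prop :=
  (forall i, ex_series (fun j => Rabs (a i j))) /\
  ex_series (fun i => Series (fun j => Rabs (a i j))).

Lemma Fubini_col (a : nat -> nat -> R) (j : nat) :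
  summable2 a -> ex_series (fun i => Rabs (a i j)).
Proof.
  intros [Hrow Htot].
  apply (ex_series_dom _ (fun i => Series (fun j => Rabs (a i j)))); [|exact Htot].
  intros i. rewrite Rabs_Rabsolu.
  apply (term_le_Series (fun j => Rabs (a i j))); [intros; apply Rabs_pos|apply Hrow].
Qed.

Lemma Fubini_col_total (a : nat -> nat -> R) :
  summable2 a -> ex_series (fun j => Series (fun i => Rabs (a i j))).
Proof.
  intros Ha. pose proof (fun j => Fubini_col a j Ha) as Hcol. destruct Ha as [Hrow Htot].
  apply (ex_series_nonneg_bounded _ (Series (fun i => Series (fun j => Rabs (a i j))))).
  - intros j. apply Series_nonneg; [intros; apply Rabs_pos|apply Hcol].
  - intros J.
    rewrite <- (is_series_unique _ _ (is_series_sum (fun j i => Rabs (a i j)) J Hcol)).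
    apply Series_le; [|exact Htot]. intros i. split.
    + apply cond_pos_sum. intros; apply Rabs_pos.
    + apply sum_le_Series; [intros; apply Rabs_pos|apply Hrow].
Qed.

(** The partial sums in i are series in j of finite sums, dominated by the
    absolute column sums, so [dominated_series] applies. *)
Lemma Fubini_series (a : nat -> nat -> R) :
  summable2 a ->
  is_series (fun i => Series (a i)) (Series (fun j => Series (fun i => a i j))).
Proof.
  intros Ha.
  assert (Hr : forall i, ex_series (a i)) by (intros; apply ex_series_Rabs, Ha).
  assert (Hc : forall j, ex_series (fun i => a i j))
    by (intros; apply (ex_series_Rabs (fun i => a i j)), Fubini_col, Ha).
  change (is_lim_seq (sum_n (fun i => Series (a i))) (Series (fun j => Series (fun i => a i j)))).
  apply (is_lim_seq_ext (fun N => Series (fun j => sum_f_R0 (fun i => a i j) N))).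
  - intros N. rewrite sum_n_Reals. apply is_series_unique, is_series_sum, Hr.
  - apply (dominated_series _ _ (fun j => Series (fun i => Rabs (a i j)))).
    + intros N j. eapply Rle_trans; [apply sum_f_R0_triangle|].
      apply (sum_le_Series (fun i => Rabs (a i j))); [intros; apply Rabs_pos|apply Fubini_col, Ha].
    + apply Fubini_col_total, Ha.
    + intros j. apply (is_lim_seq_ext (sum_n (fun i => a i j))).
      * intros n. apply sum_n_Reals.
      * exact (Series_correct (fun i => a i j) (Hc j)).
Qed.

Lemma Series_swap (a : nat -> nat -> R) :
  summable2 a ->
  Series (fun i => Series (a i)) = Series (fun j => Series (fun i => a i j)).
Proof. intros Ha. apply is_series_unique, Fubini_series, Ha. Qed.

Lemma is_series_finite (f : nat -> R) (n : nat) :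
  (forall i, (n < i)%nat -> f i = 0) -> is_series f (sum_f_R0 f n).
Proof.
  intros H.
  change (is_lim_seq (sum_n f) (sum_f_R0 f n)).
  apply (is_lim_seq_ext_loc (fun _ => sum_f_R0 f n)); [|apply is_lim_seq_const].
  exists n. intros N HN. rewrite sum_n_Reals.
  induction N as [|N IH].
  - replace n with 0%nat by lia. reflexivity.
  - destruct (Nat.eq_dec n (S N)) as [->|Hne]; [reflexivity|].
    simpl. rewrite H by lia. rewrite <- IH by lia. ring.
Qed.

Lemma Series_shift_zeros (f : nat -> R) (i : nat) :
  ex_series f ->
  is_series (fun n => if le_dec i n then f (n - i)%nat else 0) (Series f).
Proof.
  intros Hf. induction i as [|i IH].
  - apply (is_series_ext f).
    + intros n. destruct (le_dec 0 n); [f_equal; lia|lia].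
    + apply Series_correct, Hf.
  - apply is_series_decr_1. destruct (le_dec (S i) 0); [lia|].
    match goal with |- is_series _ ?l => replace l with (Series f)
      by (unfold plus, opp; simpl; ring) end.
    eapply is_series_ext; [|exact IH]. intros m. simpl.
    destruct (le_dec i m), (le_dec (S i) (S m)); try lia; reflexivity.
Qed.

(** Shifting row i by i places turns the diagonals into columns, so that
    grouping by total degree is an exchange of summations. *)
Lemma triangle_series (a : nat -> nat -> R) :
  summable2 a ->
  is_series (fun n => sum_f_R0 (fun i => a i (n - i)%nat) n)
            (Series (fun i => Series (a i))).
Proof.
  intros [Hrow Htot].
  set (b := fun i n => if le_dec i n then a i (n - i)%nat else 0).
  assert (Hb1 : forall i, is_series (b i) (Series (a i))).
  { intros i. apply Series_shift_zeros, ex_series_Rabs, Hrow. }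
  assert (Hb2 : forall i, is_series (fun n => Rabs (b i n)) (Series (fun j => Rabs (a i j)))).
  { intros i. eapply is_series_ext; [|exact (Series_shift_zeros _ i (Hrow i))].
    intros n. unfold b. simpl.
    destruct (le_dec i n); [reflexivity|rewrite Rabs_R0; reflexivity]. }
  assert (HR : forall i, ex_series (fun n => Rabs (b i n))) by (intros i; eexists; apply Hb2).
  assert (HT : ex_series (fun i => Series (fun n => Rabs (b i n)))).
  { eapply ex_series_ext; [|exact Htot]. intros i. symmetry. apply is_series_unique, Hb2. }
  assert (Hfin : forall n, Series (fun i => b i n) = sum_f_R0 (fun i => a i (n - i)%nat) n).
  { intros n. rewrite (is_series_unique _ _ (is_series_finite (fun i => b i n) n
       ltac:(intros i Hi; unfold b; destruct (le_dec i n); [lia|reflexivity]))).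
    apply sum_eq. intros i Hi. unfold b. destruct (le_dec i n); [reflexivity|lia]. }
  assert (HS : ex_series (fun n => Series (fun i => b i n))).
  { pose proof (Fubini_col_total b (conj HR HT)) as H.
    apply (ex_series_dom _ _ (fun n => Series_Rabs (fun i => b i n) (Fubini_col b n (conj HR HT))) H). }
  apply (is_series_ext (fun n => Series (fun i => b i n))); [exact Hfin|].
  replace (Series (fun i => Series (a i))) with (Series (fun n => Series (fun i => b i n))).
  - apply Series_correct, HS.
  - rewrite <- (Series_swap b (conj HR HT)). apply Series_ext. intros i. apply is_series_unique, Hb1.
Qed.

(** * Geometrically bounded coefficients *)

Lemma ex_series_geom_scal (M q : R) : 0 <= q < 1 -> ex_series (fun n => M * q ^ n).
Proof.
  intros Hq. apply (ex_series_scal_l M (fun n => q ^ n)).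
  apply ex_series_geom. rewrite Rabs_pos_eq; lra.
Qed.

Lemma Series_geom_scal (M q : R) : 0 <= q < 1 -> Series (fun n => M * q ^ n) = M / (1 - q).
Proof.
  intros Hq. rewrite Series_scal_l, Series_geom; [reflexivity|].
  rewrite Rabs_pos_eq; lra.
Qed.

Lemma summable2_geom (a : nat -> nat -> R) (M p q : R) :
  0 <= p < 1 -> 0 <= q < 1 -> (forall i j, Rabs (a i j) <= M * p ^ i * q ^ j) ->
  summable2 a.
Proof.
  intros Hp Hq H.
  assert (Hrow : forall i, ex_series (fun j => Rabs (a i j))).
  { intros i. apply (ex_series_dom_abs _ (fun j => (M * p ^ i) * q ^ j)); [apply H|].
    apply ex_series_geom_scal, Hq. }
  split; [exact Hrow|].
  apply (ex_series_dom _ (fun i => (M / (1 - q)) * p ^ i)).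
  - intros i. rewrite Rabs_pos_eq by (apply Series_nonneg; [intros; apply Rabs_pos|apply Hrow]).
    replace (M / (1 - q) * p ^ i) with ((M * p ^ i) / (1 - q)) by (field; lra).
    rewrite <- Series_geom_scal by exact Hq.
    apply Series_le; [|apply ex_series_geom_scal, Hq].
    intros j. split; [apply Rabs_pos|apply H].
  - apply ex_series_geom_scal, Hp.
Qed.

Lemma CV_radius_geom (a : nat -> R) (M s : R) :
  0 < s -> (forall n, Rabs (a n) <= M * s ^ n) -> Rbar_le (/ s) (CV_radius a).
Proof.
  intros Hs H. apply (proj1 (CV_radius_bounded a)). exists M. intros n.
  rewrite Rabs_mult, <- RPow_abs, (Rabs_pos_eq (/ s)) by (left; apply Rinv_0_lt_compat, Hs).
  rewrite pow_inv.
  apply Rmult_le_reg_r with (s ^ n); [apply pow_lt, Hs|].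
  rewrite Rmult_assoc, Rinv_l by (apply pow_nonzero; lra).
  rewrite Rmult_1_r. apply H.
Qed.

Lemma lt_CV_radius_geom (a : nat -> R) (M s t : R) :
  0 < s -> (forall n, Rabs (a n) <= M * s ^ n) -> s * Rabs t < 1 ->
  Rbar_lt (Rabs t) (CV_radius a).
Proof.
  intros Hs H Ht. apply Rbar_lt_le_trans with (/ s).
  - simpl. apply Rmult_lt_reg_l with s; [exact Hs|]. rewrite Rinv_r; lra.
  - exact (CV_radius_geom a M s Hs H).
Qed.

(** * Binomial coefficients and recentring of power series *)

(** Extended by zero above the diagonal, unlike [Binomial.C], so that Pascal's
    rule and Vandermonde's identity hold for all indices. *)
Fixpoint binom (n k : nat) : R :=
  match n, k with
  | _, 0%nat => 1
  | 0%nat, S _ => 0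
  | S n', S k' => binom n' k' + binom n' (S k')
  end.

Lemma binom_0_r (n : nat) : binom n 0 = 1.
Proof. destruct n; reflexivity. Qed.

Lemma binom_nonneg (n k : nat) : 0 <= binom n k.
Proof.
  revert k. induction n as [|n IH]; intros [|k]; simpl; try lra.
  pose proof (IH k). pose proof (IH (S k)). lra.
Qed.

Lemma binom_over (n k : nat) : (n < k)%nat -> binom n k = 0.
Proof.
  revert k. induction n as [|n IH]; intros [|k] H; simpl; try lia; [reflexivity|].
  rewrite !IH by lia. ring.
Qed.

Lemma binom_C (n k : nat) : (k <= n)%nat -> Binomial.C n k = binom n k.
Proof.
  revert k. induction n as [|n IH]; intros k H.
  - replace k with 0%nat by lia. unfold Binomial.C. simpl. field.
  - destruct k as [|k].
    + unfold Binomial.C. rewrite Nat.sub_0_r, binom_0_r.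
      change (fact 0) with 1%nat. change (INR 1) with 1. field. apply INR_fact_neq_0.
    + simpl. destruct (Nat.eq_dec k n) as [->|Hne].
      * rewrite (binom_over n (S n)), <- IH by lia.
        unfold Binomial.C. rewrite !Nat.sub_diag.
        change (fact 0) with 1%nat. change (INR 1) with 1.
        field. split; apply INR_fact_neq_0.
      * rewrite <- pascal by lia. rewrite !IH by lia. reflexivity.
Qed.

Lemma binom_expansion (x y : R) (n : nat) :
  (x + y) ^ n = sum_f_R0 (fun i => binom n i * x ^ i * y ^ (n - i)) n.
Proof.
  rewrite binomial. apply sum_eq. intros i Hi. rewrite binom_C by exact Hi. reflexivity.
Qed.

Lemma binom_term_le (x y : R) (n j : nat) :
  0 <= x -> 0 <= y -> binom (n + j) j * x ^ j * y ^ n <= (x + y) ^ (n + j).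
Proof.
  intros Hx Hy. rewrite binom_expansion.
  set (F := fun i => binom (n + j) i * x ^ i * y ^ (n + j - i)).
  replace (binom (n + j) j * x ^ j * y ^ n) with (F j)
    by (unfold F; f_equal; f_equal; lia).
  assert (HF : forall i, 0 <= F i).
  { intros i. unfold F. repeat apply Rmult_le_pos; try apply pow_le; try assumption.
    apply binom_nonneg. }
  apply term_le_sum; [exact HF|lia].
Qed.

Lemma binom_le_pow (n k : nat) : binom n k <= 2 ^ n.
Proof.
  destruct (le_lt_dec k n) as [H|H].
  - pose proof (binom_term_le 1 1 (n - k) k ltac:(lra) ltac:(lra)) as H1.
    rewrite !pow1, Nat.sub_add in H1 by exact H. replace (1 + 1) with 2 in H1 by ring. lra.
  - rewrite binom_over by exact H. apply pow_le; lra.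
Qed.

Lemma Vandermonde (m n k : nat) :
  sum_f_R0 (fun j => binom m j * binom n (k - j)) k = binom (m + n) k.
Proof.
  revert k. induction m as [|m IH]; intros k.
  - simpl. destruct k as [|k]; [simpl; rewrite !binom_0_r; ring|].
    rewrite sum_first. rewrite (sum_eq_R0 (fun i => binom 0 (S i) * _)).
    + simpl. ring.
    + intros; simpl; ring.
  - destruct k as [|k]; [simpl; rewrite !binom_0_r; ring|].
    change (binom (S m + n) (S k)) with (binom (m + n) k + binom (m + n) (S k)).
    rewrite <- !IH, !sum_first.
    rewrite (sum_eq _ (fun i => binom m i * binom n (k - i) + binom m (S i) * binom n (k - i)))
      by (intros i _; simpl; ring).
    rewrite plus_sum. simpl (S k - S _)%nat. rewrite !binom_0_r. simpl. ring.
Qed.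

(** The rule for differentiating or integrating [linpow] in h. *)
Lemma binom_absorb (n k : nat) : INR (S k) * binom (S n) (S k) = INR (S n) * binom n k.
Proof.
  revert k. induction n as [|n IH]; intros k.
  - destruct k as [|k]; simpl binom; [simpl; ring|]. ring.
  - destruct k as [|k].
    + specialize (IH 0%nat). change (binom (S (S n)) 1) with (binom (S n) 0 + binom (S n) 1).
      rewrite Rmult_plus_distr_l, IH, !binom_0_r. rewrite !S_INR. simpl INR. ring.
    + change (binom (S (S n)) (S (S k))) with (binom (S n) (S k) + binom (S n) (S (S k))).
      pose proof (IH k) as H1. pose proof (IH (S k)) as H2.
      rewrite Rmult_plus_distr_l, H2.
      change (binom (S n) (S k)) with (binom n k + binom n (S k)) in *.
      rewrite !S_INR in *. lra.
Qed.

(** The rule for integrating [linpow] in t. *)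
Lemma binom_absorb_up (n k : nat) :
  INR (S n) * binom (S n + k) k = INR (S (n + k)) * binom (n + k) k.
Proof.
  revert n. induction k as [|k IH]; intros n.
  - rewrite !Nat.add_0_r, !binom_0_r. reflexivity.
  - replace (S n + S k)%nat with (S (S (n + k))) by lia.
    replace (n + S k)%nat with (S (n + k)) by lia.
    change (binom (S (S (n + k))) (S k)) with (binom (S (n + k)) k + binom (S (n + k)) (S k)).
    pose proof (IH n) as H1. change (S n + k)%nat with (S (n + k)) in H1.
    pose proof (binom_absorb (n + k) k) as H2.
    rewrite Rmult_plus_distr_l, H1, <- H2. rewrite !S_INR, plus_INR. ring.
Qed.

(** The Taylor coefficients at z of the power series with coefficients a. *)
Definition recentre (a : nat -> R) (z : R) (j : nat) : R :=
  Series (fun n => binom (n + j) j * a (n + j)%nat * z ^ n).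

(** Cauchy's estimate: the binomial coefficient times |z|^n rho^j is one term
    of (|z| + rho)^(n + j), so that dividing by rho^j leaves a geometric series
    in n. *)
Lemma recentre_term_bound (a : nat -> R) (M s z rho : R) (n j : nat) :
  0 < s -> 0 < rho -> s * (Rabs z + rho) < 1 -> (forall n, Rabs (a n) <= M * s ^ n) ->
  Rabs (binom (n + j) j * a (n + j)%nat * z ^ n)
    <= (M * (/ rho) ^ j) * (s * (Rabs z + rho)) ^ n.
Proof.
  intros Hs Hr Ht Ha.
  assert (HM : 0 <= M).
  { specialize (Ha 0%nat). simpl in Ha. pose proof (Rabs_pos (a 0%nat)). lra. }
  pose proof (Rabs_pos z) as Hz.
  set (th := s * (Rabs z + rho)) in *.
  assert (Hth : 0 <= th) by (unfold th; apply Rmult_le_pos; lra).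
  rewrite !Rabs_mult, (Rabs_pos_eq (binom _ _)) by apply binom_nonneg.
  rewrite <- RPow_abs.
  pose proof (binom_term_le rho (Rabs z) n j ltac:(lra) Hz) as H1.
  pose proof (Ha (n + j)%nat) as H2.
  assert (Hrj : 0 < rho ^ j) by (apply pow_lt, Hr).
  apply Rmult_le_reg_r with (rho ^ j); [exact Hrj|].
  rewrite pow_inv.
  replace (M * / rho ^ j * th ^ n * rho ^ j) with (M * th ^ n) by (field; lra).
  apply Rle_trans with ((M * s ^ (n + j)) * (Rabs z + rho) ^ (n + j)).
  - replace (binom (n + j) j * Rabs (a (n + j)%nat) * Rabs z ^ n * rho ^ j)
      with (Rabs (a (n + j)%nat) * (binom (n + j) j * rho ^ j * Rabs z ^ n)) by ring.
    apply Rmult_le_compat; [apply Rabs_pos| |exact H2|].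
    + repeat apply Rmult_le_pos; try apply pow_le; try lra. apply binom_nonneg.
    + rewrite (Rplus_comm (Rabs z)). exact H1.
  - rewrite Rmult_assoc, <- Rpow_mult_distr. fold th.
    apply Rmult_le_compat_l; [exact HM|].
    rewrite pow_add. rewrite <- (Rmult_1_r (th ^ n)) at 2.
    apply Rmult_le_compat_l; [apply pow_le, Hth|].
    rewrite <- (pow1 j). apply pow_incr. lra.
Qed.

Lemma recentre_ex (a : nat -> R) (M s z : R) (j : nat) :
  0 < s -> s * Rabs z < 1 -> (forall n, Rabs (a n) <= M * s ^ n) ->
  ex_series (fun n => binom (n + j) j * a (n + j)%nat * z ^ n).
Proof.
  intros Hs Ht Ha.
  set (rho := (/ s - Rabs z) / 2).
  assert (Hz : Rabs z < / s).
  { apply Rmult_lt_reg_l with s; [exact Hs|]. rewrite Rinv_r; lra. }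
  assert (Hr : 0 < rho) by (unfold rho; lra).
  assert (Hth : s * (Rabs z + rho) < 1).
  { unfold rho. replace (s * (Rabs z + (/ s - Rabs z) / 2)) with ((s * Rabs z + 1) / 2)
      by (field; lra). lra. }
  eapply ex_series_dom.
  - intros n. exact (recentre_term_bound a M s z rho n j Hs Hr Hth Ha).
  - apply ex_series_geom_scal. split; [|exact Hth].
    apply Rmult_le_pos; [lra|]. pose proof (Rabs_pos z). lra.
Qed.

Lemma recentre_bound (a : nat -> R) (M s z rho : R) (j : nat) :
  0 < s -> 0 < rho -> s * (Rabs z + rho) < 1 -> (forall n, Rabs (a n) <= M * s ^ n) ->
  Rabs (recentre a z j) <= M / (1 - s * (Rabs z + rho)) * (/ rho) ^ j.
Proof.
  intros Hs Hr Hth Ha.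
  assert (H0 : 0 <= s * (Rabs z + rho)).
  { apply Rmult_le_pos; [lra|]. pose proof (Rabs_pos z). lra. }
  replace (M / (1 - s * (Rabs z + rho)) * (/ rho) ^ j)
    with ((M * (/ rho) ^ j) / (1 - s * (Rabs z + rho))) by (field; lra).
  rewrite <- Series_geom_scal by (split; assumption).
  apply Series_abs_le.
  - intros n. exact (recentre_term_bound a M s z rho n j Hs Hr Hth Ha).
  - apply ex_series_geom_scal. split; assumption.
Qed.

(** Expand (z + h)^n by the binomial theorem and exchange the sums. *)
Lemma recentre_sum (a : nat -> R) (M s z h : R) :
  0 < s -> s * (Rabs z + Rabs h) < 1 -> (forall n, Rabs (a n) <= M * s ^ n) ->
  PSeries a (z + h) = PSeries (recentre a z) h.
Proof.
  intros Hs Ht Ha.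
  pose proof (Rabs_pos z) as Hz. pose proof (Rabs_pos h) as Hh.
  assert (Hsz : s * Rabs z < 1).
  { apply Rle_lt_trans with (2 := Ht). apply Rmult_le_compat_l; lra. }
  set (th := s * (Rabs z + Rabs h)) in *.
  assert (Hth : 0 <= th) by (unfold th; apply Rmult_le_pos; lra).
  set (c := fun n j => if le_dec j n then a n * (binom n j * h ^ j * z ^ (n - j)) else 0).
  assert (Hrow : forall n, is_series (c n) (a n * (z + h) ^ n)).
  { intros n. rewrite (Rplus_comm z), binom_expansion, scal_sum.
    rewrite (sum_eq _ (c n)).
    - apply is_series_finite. intros i Hi. unfold c. destruct (le_dec i n); [lia|reflexivity].
    - intros i Hi. unfold c. destruct (le_dec i n); [ring|lia]. }
  assert (Habs : forall n, is_series (fun j => Rabs (c n j)) (Rabs (a n) * (Rabs z + Rabs h) ^ n)).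
  { intros n. rewrite (Rplus_comm (Rabs z)), binom_expansion, scal_sum.
    rewrite (sum_eq _ (fun j => Rabs (c n j))).
    - apply is_series_finite. intros i Hi. unfold c. destruct (le_dec i n); [lia|apply Rabs_R0].
    - intros i Hi. unfold c. destruct (le_dec i n); [|lia].
      rewrite !Rabs_mult, <- !RPow_abs, (Rabs_pos_eq (binom n i)) by apply binom_nonneg. ring. }
  assert (Hsum : summable2 c).
  { split; [intros n; eexists; apply Habs|].
    apply (ex_series_dom _ (fun n => M * th ^ n)).
    - intros n. rewrite (is_series_unique _ _ (Habs n)).
      rewrite Rabs_pos_eq by (apply Rmult_le_pos; [apply Rabs_pos|apply pow_le; lra]).
      unfold th. rewrite Rpow_mult_distr, <- Rmult_assoc.
      apply Rmult_le_compat_r; [apply pow_le; lra|apply Ha].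
    - apply ex_series_geom_scal. split; assumption. }
  unfold PSeries at 1.
  rewrite (Series_ext _ (fun n => Series (c n)))
    by (intros n; symmetry; apply is_series_unique, Hrow).
  rewrite Series_swap by exact Hsum.
  unfold PSeries. apply Series_ext. intros j. unfold recentre.
  rewrite <- Series_scal_r.
  rewrite <- (is_series_unique _ _ (Series_shift_zeros _ j
     (ex_series_scal_r (h ^ j) _ (recentre_ex a M s z j Hs Hsz Ha)))).
  apply Series_ext. intros n. unfold c. destruct (le_dec j n) as [Hj|Hj]; [|reflexivity].
  rewrite Nat.sub_add by exact Hj. ring.
Qed.

(** * The inverse derivative on the circle *)

Lemma periodic1_IZR (f : R -> R) (x : R) (z : Z) : periodic1 f -> f (x + IZR z) = f x.
Proof.
  intros Hf.
  assert (Hn : forall n y, f (y + INR n) = f y).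
  { induction n as [|n IH]; intros y; [simpl; f_equal; ring|].
    rewrite S_INR, <- Rplus_assoc, Hf. apply IH. }
  destruct (Z_le_gt_dec 0 z) as [Hz|Hz].
  - rewrite <- (Z2Nat.id z Hz), <- INR_IZR_INZ. apply Hn.
  - rewrite <- (Hn (Z.to_nat (- z)) (x + IZR z)). f_equal.
    rewrite INR_IZR_INZ, Z2Nat.id, opp_IZR by lia. ring.
Qed.

Lemma circle_representative (x : R) :
  exists y, 0 <= y <= 1 /\ exists z : Z, x = y + IZR z.
Proof.
  exists (frac_part x). split.
  - destruct (base_fp x). lra.
  - exists (Int_part x). unfold frac_part. ring.
Qed.

Lemma ex_RInt_cont (g : R -> R) (a b : R) : (forall x, continuous g x) -> ex_RInt g a b.
Proof. intros H. apply (ex_RInt_continuous g). intros; apply H. Qed.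

Lemma continuous_of_derive (f df : R -> R) :
  (forall x, is_derive f x (df x)) -> forall x, continuous f x.
Proof. intros H x. apply (ex_derive_continuous f). eexists. apply H. Qed.

Lemma RInt_of_derive (f df : R -> R) (a b : R) :
  (forall x, is_derive f x (df x)) -> (forall x, continuous df x) ->
  RInt df a b = f b - f a.
Proof.
  intros H1 H2. apply is_RInt_unique. apply (is_RInt_derive f df); intros; [apply H1|apply H2].
Qed.

Lemma circle_int_minus_const (f : R -> R) (c : R) :
  (forall x, continuous f x) -> circle_int (fun x => f x - c) = circle_int f - c.
Proof.
  intros Hf. unfold circle_int.
  rewrite (RInt_minus (V := R_CompleteNormedModule) f (fun _ => c)).
  - rewrite RInt_const. unfold minus, plus, opp, scal; simpl. unfold mult; simpl. ring.
  - apply ex_RInt_cont, Hf.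
  - apply ex_RInt_const.
Qed.

Lemma mean_zero_part_mean (f : R -> R) :
  (forall x, continuous f x) -> circle_int (mean_zero_part f) = 0.
Proof.
  intros Hf. unfold mean_zero_part. rewrite circle_int_minus_const by exact Hf. ring.
Qed.

Lemma dx_inv_derive (x0 : R) (g : R -> R) (x : R) :
  (forall x, continuous g x) -> is_derive (dx_inv x0 g) x (g x).
Proof.
  intros Hg. unfold dx_inv.
  replace (g x) with (minus (g x) zero) by (unfold minus, plus, opp, zero; simpl; ring).
  apply (is_derive_minus (fun x => RInt g x0 x) (fun _ => circle_int _)).
  - apply (is_derive_RInt g (fun x => RInt g x0 x) x0 x); [|apply Hg].
    apply filter_forall. intros y.
    apply (RInt_correct (V := R_CompleteNormedModule)), ex_RInt_cont, Hg.
  - apply (is_derive_const (K := R_AbsRing) (V := R_NormedModule)).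
Qed.

(** Whatever the base point x0, the operator picks the primitive of mean zero.
    This reduces every question about it to one about a known primitive. *)
Lemma dx_inv_unique (x0 : R) (W g : R -> R) (x : R) :
  (forall x, is_derive W x (g x)) -> (forall x, continuous g x) -> circle_int W = 0 ->
  dx_inv x0 g x = W x.
Proof.
  intros HW Hg H0. unfold dx_inv.
  rewrite (RInt_of_derive W g) by assumption.
  replace (fun z => RInt g x0 z) with (fun z => W z - W x0)
    by (apply functional_extensionality; intros z; symmetry; apply RInt_of_derive; assumption).
  rewrite circle_int_minus_const by (apply (continuous_of_derive W g), HW).
  rewrite H0. ring.
Qed.

Lemma dx_inv_mean (x0 : R) (g : R -> R) :
  (forall x, continuous g x) -> circle_int (dx_inv x0 g) = 0.
Proof.
  intros Hg. unfold dx_inv.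
  rewrite (circle_int_minus_const (fun x => RInt g x0 x)); [ring|].
  intros x.
  apply (continuous_ext (fun x => dx_inv x0 g x + circle_int (fun z => RInt g x0 z))).
  - intros y. unfold dx_inv. simpl. ring.
  - apply (continuous_plus (dx_inv x0 g) (fun _ => circle_int (fun z => RInt g x0 z))).
    + apply (continuous_of_derive _ g). intros; apply dx_inv_derive, Hg.
    + apply continuous_const.
Qed.

Lemma bounded_increment (W g : R -> R) (B x y : R) :
  (forall x, is_derive W x (g x)) -> (forall x, Rabs (g x) <= B) ->
  Rabs (W x - W y) <= B * Rabs (x - y).
Proof.
  intros HW HB.
  destruct (MVT_gen W y x g) as [c [_ Hc]].
  - intros; apply HW.
  - intros. apply continuity_pt_filterlim, (continuous_of_derive W g HW).
  - rewrite Hc, Rabs_mult. apply Rmult_le_compat_r; [apply Rabs_pos|apply HB].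
Qed.

Lemma derive_zero_const (W : R -> R) (x y : R) :
  (forall x, is_derive W x 0) -> W x = W y.
Proof.
  intros HW.
  assert (H0 : R -> Rabs 0 <= 0) by (intros; rewrite Rabs_R0; lra).
  pose proof (bounded_increment W (fun _ => 0) 0 x y HW H0) as H.
  rewrite Rmult_0_l in H. pose proof (Rabs_pos (W x - W y)) as H2.
  assert (H1 : Rabs (W x - W y) = 0) by lra. apply Rabs_eq_0 in H1. lra.
Qed.

(** The increment of W over one period has derivative zero, hence equals its
    value at 0, which is the mean of g. *)
Lemma primitive_periodic (W g : R -> R) :
  (forall x, is_derive W x (g x)) -> (forall x, continuous g x) ->
  periodic1 g -> circle_int g = 0 -> periodic1 W.
Proof.
  intros HW Hg Hp H0 x.
  assert (H1 : W 1 - W 0 = 0) by (rewrite <- (RInt_of_derive W g 0 1 HW Hg); exact H0).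
  assert (H2 : W (x + 1) - W x = W (0 + 1) - W 0).
  { apply (derive_zero_const (fun y => W (y + 1) - W y)). intros y.
    replace 0 with (minus (scal 1 (g (y + 1))) (g y)).
    - apply (is_derive_minus (fun y => W (y + 1)) W); [|apply HW].
      apply (is_derive_comp W (fun y => y + 1)); [apply HW|].
      auto_derive; [exact I|ring].
    - rewrite Hp. unfold minus, plus, opp, scal; simpl. unfold mult; simpl. ring. }
  rewrite Rplus_0_l in H2. lra.
Qed.

(** If W has mean zero then - W y is the average over one period of the
    increments W s - W y, and each of these is at most B. *)
Lemma mean_zero_bound (W g : R -> R) (B x : R) :
  (forall x, is_derive W x (g x)) -> (forall x, Rabs (g x) <= B) ->
  periodic1 W -> circle_int W = 0 -> Rabs (W x) <= B.
Proof.
  intros HW HB Hp H0.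
  assert (Hc := continuous_of_derive W g HW).
  destruct (circle_representative x) as [y [Hy [z ->]]].
  rewrite periodic1_IZR by exact Hp.
  assert (H1 : RInt (fun s => W s - W y) 0 1 = - W y).
  { change (circle_int (fun s => W s - W y) = - W y).
    rewrite circle_int_minus_const by exact Hc. rewrite H0. ring. }
  rewrite <- Rabs_Ropp, <- H1.
  replace B with ((1 - 0) * B) by ring.
  apply abs_RInt_le_const; [lra| |].
  - apply ex_RInt_cont. intros s. apply (continuous_minus W (fun _ => W y)); [apply Hc|].
    apply continuous_const.
  - intros s Hs. eapply Rle_trans; [apply (bounded_increment W g B); assumption|].
    pose proof (HB 0). pose proof (Rabs_pos (g 0)).
    rewrite <- (Rmult_1_r B) at 2. apply Rmult_le_compat_l; [lra|].
    apply Rabs_le. lra.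
Qed.

Lemma circle_int_bound (f : R -> R) (B : R) :
  (forall x, continuous f x) -> (forall x, Rabs (f x) <= B) -> Rabs (circle_int f) <= B.
Proof.
  intros Hf HB. replace B with ((1 - 0) * B) by ring.
  apply abs_RInt_le_const; [lra|apply ex_RInt_cont, Hf|intros; apply HB].
Qed.

Lemma mean_zero_part_bound (f : R -> R) (B x : R) :
  (forall x, continuous f x) -> (forall x, Rabs (f x) <= B) ->
  Rabs (mean_zero_part f x) <= 2 * B.
Proof.
  intros Hf HB. unfold mean_zero_part.
  pose proof (circle_int_bound f B Hf HB) as H1. specialize (HB x).
  apply Rabs_le_between in H1. apply Rabs_le_between in HB. apply Rabs_le. lra.
Qed.

Lemma mean_zero_part_continuous (f : R -> R) (x : R) :
  continuous f x -> continuous (mean_zero_part f) x.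
Proof.
  intros Hf. apply (continuous_minus f (fun _ => circle_int f)); [exact Hf|apply continuous_const].
Qed.

(** * Jets *)

(** [a n k x] is meant to be the coefficient of t^n h^k in the expansion of a
    function of (x + h, t). *)
Definition jets := nat -> nat -> R -> R.

(** Equivalently, [a n k] is the x-derivative of order k of [a n 0] divided by
    k!. *)
Definition jet (a : jets) : Prop :=
  forall n k x, is_derive (a n k) x (INR (S k) * a n (S k) x).

Definition periodic_jets (a : jets) : Prop := forall n k, periodic1 (a n k).

(** A single constant bounds both the size and the two geometric rates, which
    leaves only one number to track through products and derivatives. *)
Definition geometric (L : R) (a : jets) : Prop :=
  forall n k x, Rabs (a n k x) <= L ^ (n + k + 1).

Definition good (a : jets) : Prop :=
  jet a /\ periodic_jets a /\ exists L, 1 <= L /\ geometric L a.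

Definition conv (a b : jets) : jets := fun n k x =>
  sum_f_R0 (fun i => sum_f_R0 (fun j => a i j x * b (n - i)%nat (k - j)%nat x) k) n.

Definition Dx (a : jets) : jets := fun n k x => INR (S k) * a n (S k) x.

Definition one_jets : jets := fun n k _ => match n, k with 0%nat, 0%nat => 1 | _, _ => 0 end.

Fixpoint pow_jets (a : jets) (p : nat) : jets :=
  match p with 0%nat => one_jets | S p' => conv a (pow_jets a p') end.

(** Jets of [dx_inv] applied to the mean-zero part. Only order 0 needs an
    integration: the first derivative gives the mean-zero part back. *)
Definition Dinv (x0 : R) (a : jets) : jets := fun n k x =>
  match k with
  | 0%nat => dx_inv x0 (mean_zero_part (a n 0%nat)) x
  | S k' => / INR k * match k' with 0%nat => mean_zero_part (a n 0%nat) x | _ => a n k' x end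
  end.

Definition lincomb (c : R) (a : jets) (d : R) (b : jets) : jets :=
  fun n k x => c * a n k x + d * b n k x.

(** Split the factor S k of the term of index j as j + (S k - j). *)
Lemma Leibniz_coef (A B : nat -> R) (k : nat) :
  INR (S k) * sum_f_R0 (fun j => A j * B (S k - j)%nat) (S k) =
  sum_f_R0 (fun j => (INR (S j) * A (S j)) * B (k - j)%nat) k +
  sum_f_R0 (fun j => A j * (INR (S (k - j)) * B (S (k - j)))) k.
Proof.
  rewrite scal_sum.
  rewrite (sum_eq _ (fun j => INR j * A j * B (S k - j)%nat + INR (S k - j) * A j * B (S k - j)%nat)).
  - rewrite plus_sum. f_equal.
    + rewrite sum_first. simpl (INR 0). rewrite !Rmult_0_l, Rplus_0_l. reflexivity.
    + rewrite tech5, Nat.sub_diag. simpl (INR 0). rewrite !Rmult_0_l, Rplus_0_r.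
      apply sum_eq. intros j Hj. replace (S k - j)%nat with (S (k - j)) by lia. ring.
  - intros j Hj. rewrite (minus_INR (S k) j) by exact Hj. ring.
Qed.

Lemma Dx_conv (a b : jets) (n k : nat) (x : R) :
  Dx (conv a b) n k x = conv (Dx a) b n k x + conv a (Dx b) n k x.
Proof.
  unfold Dx, conv. rewrite scal_sum, <- plus_sum. apply sum_eq. intros i _.
  rewrite Rmult_comm, (Leibniz_coef (fun j => a i j x) (fun j => b (n - i)%nat j x)).
  reflexivity.
Qed.

Lemma is_derive_sum_f (F dF : nat -> R -> R) (n : nat) (x : R) :
  (forall i, is_derive (F i) x (dF i x)) ->
  is_derive (fun y => sum_f_R0 (fun i => F i y) n) x (sum_f_R0 (fun i => dF i x) n).
Proof.
  intros H. induction n as [|n IH]; simpl.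
  - apply H.
  - apply (is_derive_plus _ (F (S n)) x _ _ IH (H (S n))).
Qed.

Lemma jet_conv (a b : jets) : jet a -> jet b -> jet (conv a b).
Proof.
  intros Ha Hb n k x. fold (Dx (conv a b) n k x). rewrite Dx_conv.
  unfold conv. rewrite <- plus_sum.
  apply (is_derive_sum_f (fun i y => sum_f_R0 (fun j => a i j y * b (n - i)%nat (k - j)%nat y) k)
    (fun i y => sum_f_R0 (fun j => Dx a i j y * b (n - i)%nat (k - j)%nat y) k +
                sum_f_R0 (fun j => a i j y * Dx b (n - i)%nat (k - j)%nat y) k)).
  intros i. rewrite <- plus_sum.
  apply (is_derive_sum_f (fun j y => a i j y * b (n - i)%nat (k - j)%nat y)
    (fun j y => Dx a i j y * b (n - i)%nat (k - j)%nat y + a i j y * Dx b (n - i)%nat (k - j)%nat y)).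
  intros j. apply (is_derive_mult (K := R_AbsRing) (a i j) (b (n - i)%nat (k - j)%nat)).
  - apply Ha.
  - apply Hb.
  - intros; apply Rmult_comm.
Qed.

Lemma jet_Dx (a : jets) : jet a -> jet (Dx a).
Proof.
  intros Ha n k x. unfold Dx.
  apply (is_derive_scal (a n (S k)) x (INR (S k))). apply Ha.
Qed.

Lemma jet_lincomb (c d : R) (a b : jets) : jet a -> jet b -> jet (lincomb c a d b).
Proof.
  intros Ha Hb n k x. unfold lincomb.
  replace (INR (S k) * (c * a n (S k) x + d * b n (S k) x))
    with (plus (c * (INR (S k) * a n (S k) x)) (d * (INR (S k) * b n (S k) x)))
    by (unfold plus; simpl; ring).
  apply (is_derive_plus (fun y => c * a n k y) (fun y => d * b n k y)).
  - apply (is_derive_scal (a n k) x c). apply Ha.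
  - apply (is_derive_scal (b n k) x d). apply Hb.
Qed.

Lemma jet_one_jets : jet one_jets.
Proof.
  intros n k x. replace (INR (S k) * one_jets n (S k) x) with (@zero R_AbelianMonoid)
    by (unfold zero; destruct n; simpl one_jets; simpl; ring).
  apply (is_derive_const (K := R_AbsRing) (V := R_NormedModule)).
Qed.

Lemma jet_continuous (a : jets) (n k : nat) (x : R) : jet a -> continuous (a n k) x.
Proof. intros Ha. apply (continuous_of_derive (a n k) _ (Ha n k)). Qed.

Lemma jet_Dinv (x0 : R) (a : jets) : jet a -> jet (Dinv x0 a).
Proof.
  intros Ha n k x. destruct k as [|[|k]].
  - simpl INR. simpl Dinv.
    replace (1 * (/ 1 * mean_zero_part (a n 0%nat) x)) with (mean_zero_part (a n 0%nat) x) by field.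
    apply dx_inv_derive. intros y. apply mean_zero_part_continuous, jet_continuous, Ha.
  - change (is_derive (fun y => / INR 1 * mean_zero_part (a n 0%nat) y) x
      (INR 2 * (/ INR 2 * a n 1%nat x))).
    replace (INR 2 * (/ INR 2 * a n 1%nat x)) with (/ INR 1 * (minus (INR 1 * a n 1%nat x) zero))
      by (unfold minus, plus, opp, zero; simpl; field).
    apply (is_derive_scal (mean_zero_part (a n 0%nat)) x (/ INR 1)).
    apply (is_derive_minus (a n 0%nat) (fun _ => circle_int (a n 0%nat))); [apply Ha|].
    apply (is_derive_const (K := R_AbsRing) (V := R_NormedModule)).
  - change (is_derive (fun y => / INR (S (S k)) * a n (S k) y) x
      (INR (S (S (S k))) * (/ INR (S (S (S k))) * a n (S (S k)) x))).
    replace (INR (S (S (S k))) * (/ INR (S (S (S k))) * a n (S (S k)) x))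
      with (/ INR (S (S k)) * (INR (S (S k)) * a n (S (S k)) x))
      by (field; split; apply not_0_INR; lia).
    apply (is_derive_scal (a n (S k)) x (/ INR (S (S k)))). apply Ha.
Qed.

Lemma periodic_conv (a b : jets) :
  periodic_jets a -> periodic_jets b -> periodic_jets (conv a b).
Proof.
  intros Ha Hb n k x. unfold conv. apply sum_eq; intros i _. apply sum_eq; intros j _.
  rewrite (Ha i j x), (Hb _ _ x). reflexivity.
Qed.

Lemma periodic_Dx (a : jets) : periodic_jets a -> periodic_jets (Dx a).
Proof. intros Ha n k x. unfold Dx. rewrite (Ha n (S k) x). reflexivity. Qed.

Lemma periodic_lincomb (c d : R) (a b : jets) :
  periodic_jets a -> periodic_jets b -> periodic_jets (lincomb c a d b).
Proof. intros Ha Hb n k x. unfold lincomb. rewrite (Ha n k x), (Hb n k x). reflexivity. Qed.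

Lemma periodic_Dinv (x0 : R) (a : jets) :
  jet a -> periodic_jets a -> periodic_jets (Dinv x0 a).
Proof.
  intros Hj Ha n k.
  assert (Hm : periodic1 (mean_zero_part (a n 0%nat))).
  { intros x. unfold mean_zero_part. rewrite (Ha n 0%nat x). reflexivity. }
  destruct k as [|[|k]].
  - apply (primitive_periodic _ (mean_zero_part (a n 0%nat))).
    + intros x. apply dx_inv_derive. intros y. apply mean_zero_part_continuous, jet_continuous, Hj.
    + intros y. apply mean_zero_part_continuous, jet_continuous, Hj.
    + exact Hm.
    + apply mean_zero_part_mean. intros y. apply jet_continuous, Hj.
  - intros x. simpl. rewrite Hm. reflexivity.
  - intros x. change (/ INR (S (S k)) * a n (S k) (x + 1) = / INR (S (S k)) * a n (S k) x).
    rewrite (Ha n (S k) x). reflexivity.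
Qed.

Lemma Dinv_0_bound (x0 : R) (a : jets) (n : nat) (B x : R) :
  jet a -> periodic_jets a -> (forall x, Rabs (a n 0%nat x) <= B) ->
  Rabs (Dinv x0 a n 0%nat x) <= 2 * B.
Proof.
  intros Hj Hp HB.
  assert (Hc : forall y, continuous (a n 0%nat) y) by (intros; apply jet_continuous, Hj).
  assert (Hmc : forall y, continuous (mean_zero_part (a n 0%nat)) y)
    by (intros; apply mean_zero_part_continuous, Hc).
  apply (mean_zero_bound _ (mean_zero_part (a n 0%nat))).
  - intros y. apply dx_inv_derive, Hmc.
  - intros y. apply mean_zero_part_bound; assumption.
  - apply (periodic_Dinv x0 a Hj Hp n 0%nat).
  - apply dx_inv_mean, Hmc.
Qed.

Lemma Dinv_S_bound (x0 : R) (a : jets) (n k : nat) (B x : R) :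
  jet a -> (forall x, Rabs (a n k x) <= B) ->
  Rabs (Dinv x0 a n (S k) x) <= 2 * B / INR (S k).
Proof.
  intros Hj HB. simpl Dinv.
  assert (Hk : 0 < INR (S k)) by (apply lt_0_INR; lia).
  rewrite Rabs_mult, (Rabs_pos_eq (/ _)) by (left; apply Rinv_0_lt_compat, Hk).
  rewrite Rmult_comm. apply Rmult_le_compat_r; [left; apply Rinv_0_lt_compat, Hk|].
  destruct k as [|k].
  - apply mean_zero_part_bound; [intros; apply jet_continuous, Hj|exact HB].
  - pose proof (HB x). pose proof (Rabs_pos (a n (S k) x)). lra.
Qed.

(** * Jets of geometric growth *)

Lemma INR_S_le_pow2 (n : nat) : INR (S n) <= 2 ^ n.
Proof.
  induction n as [|n IH]; [simpl; lra|]. rewrite S_INR.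
  change (2 ^ S n) with (2 * 2 ^ n). assert (1 <= 2 ^ n) by (apply pow_R1_Rle; lra). lra.
Qed.

Lemma geometric_mono (L L' : R) (a : jets) :
  0 <= L <= L' -> geometric L a -> geometric L' a.
Proof.
  intros HL Ha n k x. eapply Rle_trans; [apply Ha|]. apply pow_incr, HL.
Qed.

(** The number (n + 1) (k + 1) of terms is absorbed by the factor 2^(n + k). *)
Lemma geometric_conv (L : R) (a b : jets) :
  1 <= L -> geometric L a -> geometric L b -> geometric (2 * (L * L)) (conv a b).
Proof.
  intros HL Ha Hb n k x.
  assert (H : Rabs (conv a b n k x) <= (L ^ (n + k + 2) * INR (S k)) * INR (S n)).
  { unfold conv. eapply Rle_trans; [apply sum_f_R0_triangle|].
    rewrite <- sum_cte. apply sum_Rle. intros i Hi.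
    eapply Rle_trans; [apply sum_f_R0_triangle|].
    rewrite <- sum_cte. apply sum_Rle. intros j Hj.
    rewrite Rabs_mult.
    replace (n + k + 2)%nat with ((i + j + 1) + ((n - i) + (k - j) + 1))%nat by lia.
    rewrite pow_add. apply Rmult_le_compat; try apply Rabs_pos; [apply Ha|apply Hb]. }
  eapply Rle_trans; [exact H|].
  assert (HP : forall m, 0 < L ^ m) by (intros; apply pow_lt; lra).
  apply Rle_trans with (L ^ (n + k + 2) * 2 ^ k * 2 ^ n).
  - apply Rmult_le_compat; try apply INR_S_le_pow2; try apply pos_INR.
    + apply Rmult_le_pos; [left; apply HP|apply pos_INR].
    + apply Rmult_le_compat_l; [left; apply HP|apply INR_S_le_pow2].
  - rewrite !Rpow_mult_distr, <- pow_add.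
    replace (L ^ (n + k + 2) * 2 ^ k * 2 ^ n) with (2 ^ (k + n) * L ^ (n + k + 2))
      by (rewrite (pow_add 2 k n); ring).
    apply Rmult_le_compat; [apply pow_le; lra|left; apply HP| |].
    + apply Rle_pow; [lra|lia].
    + apply Rle_pow; [lra|lia].
Qed.

Lemma geometric_Dx (L : R) (a : jets) :
  1 <= L -> geometric L a -> geometric (2 * (L * L)) (Dx a).
Proof.
  intros HL Ha n k x. unfold Dx. rewrite Rabs_mult, Rabs_pos_eq by apply pos_INR.
  assert (HP : forall m, 0 < L ^ m) by (intros; apply pow_lt; lra).
  apply Rle_trans with (2 ^ k * L ^ (n + S k + 1)).
  - apply Rmult_le_compat; [apply pos_INR|apply Rabs_pos|apply INR_S_le_pow2|apply Ha].
  - rewrite !Rpow_mult_distr, <- pow_add.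
    apply Rmult_le_compat; [apply pow_le; lra|left; apply HP| |].
    + apply Rle_pow; [lra|lia].
    + apply Rle_pow; [lra|lia].
Qed.

Lemma geometric_one_jets : geometric 1 one_jets.
Proof.
  intros n k x. rewrite pow1. unfold one_jets.
  destruct n, k; rewrite ?Rabs_R0, ?Rabs_R1; lra.
Qed.

Lemma geometric_lincomb (c d L : R) (a b : jets) :
  1 <= L -> geometric L a -> geometric L b ->
  geometric ((Rabs c + Rabs d + 1) * L) (lincomb c a d b).
Proof.
  intros HL Ha Hb n k x. unfold lincomb.
  pose proof (Rabs_pos c). pose proof (Rabs_pos d).
  eapply Rle_trans; [apply Rabs_triang|]. rewrite !Rabs_mult.
  specialize (Ha n k x). specialize (Hb n k x).
  assert (HP : 0 < L ^ (n + k + 1)) by (apply pow_lt; lra).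
  apply Rle_trans with ((Rabs c + Rabs d) * L ^ (n + k + 1)).
  - rewrite Rmult_plus_distr_r. apply Rplus_le_compat; apply Rmult_le_compat_l; lra.
  - rewrite Rpow_mult_distr. apply Rmult_le_compat_r; [lra|].
    apply Rle_trans with (Rabs c + Rabs d + 1); [lra|].
    rewrite <- (pow_1 (Rabs c + Rabs d + 1)) at 1. apply Rle_pow; [lra|lia].
Qed.

Lemma geometric_Dinv (x0 L : R) (a : jets) :
  1 <= L -> jet a -> periodic_jets a -> geometric L a -> geometric (2 * L) (Dinv x0 a).
Proof.
  intros HL Hj Hp Ha n k x. rewrite Rpow_mult_distr.
  assert (H2 : forall m, 2 <= 2 ^ (m + 1)).
  { intros m. rewrite pow_add, pow_1. assert (1 <= 2 ^ m) by (apply pow_R1_Rle; lra). lra. }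
  assert (HP : forall m, 0 < L ^ m) by (intros; apply pow_lt; lra).
  destruct k as [|k].
  - eapply Rle_trans; [apply (Dinv_0_bound x0 a n (L ^ (n + 0 + 1))); try assumption|].
    + intros y. apply Ha.
    + apply Rmult_le_compat_r; [left; apply HP|apply H2].
  - eapply Rle_trans; [apply (Dinv_S_bound x0 a n k (L ^ (n + k + 1))); try assumption|].
    + intros y. apply Ha.
    + apply Rle_trans with (2 * L ^ (n + k + 1)).
      * apply Rmult_le_reg_r with (INR (S k)); [apply lt_0_INR; lia|].
        unfold Rdiv. rewrite Rmult_assoc, Rinv_l by (apply not_0_INR; lia).
        apply Rmult_le_compat_l; [specialize (HP (n + k + 1)%nat); lra|].
        rewrite S_INR. pose proof (pos_INR k). lra.
      * apply Rmult_le_compat; [lra|left; apply HP|apply H2|apply Rle_pow; [lra|lia]].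
Qed.

Lemma good_common (a b : jets) :
  good a -> good b -> exists L, 1 <= L /\ geometric L a /\ geometric L b.
Proof.
  intros [_ [_ [L [HL Ha]]]] [_ [_ [L' [HL' Hb]]]].
  pose proof (Rmax_l L L'). pose proof (Rmax_r L L').
  exists (Rmax L L'). split; [lra|]. split.
  - apply (geometric_mono L); [lra|exact Ha].
  - apply (geometric_mono L'); [lra|exact Hb].
Qed.

Lemma good_conv (a b : jets) : good a -> good b -> good (conv a b).
Proof.
  intros Ha Hb. destruct (good_common a b Ha Hb) as [L [HL [H1 H2]]].
  destruct Ha as [Ha1 [Ha2 _]], Hb as [Hb1 [Hb2 _]].
  split; [apply jet_conv; assumption|]. split; [apply periodic_conv; assumption|].
  exists (2 * (L * L)). split; [nra|apply geometric_conv; assumption].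
Qed.

Lemma good_Dx (a : jets) : good a -> good (Dx a).
Proof.
  intros [Ha1 [Ha2 [L [HL H]]]].
  split; [apply jet_Dx; assumption|]. split; [apply periodic_Dx; assumption|].
  exists (2 * (L * L)). split; [nra|apply geometric_Dx; assumption].
Qed.

Lemma good_lincomb (c d : R) (a b : jets) : good a -> good b -> good (lincomb c a d b).
Proof.
  intros Ha Hb. destruct (good_common a b Ha Hb) as [L [HL [H1 H2]]].
  destruct Ha as [Ha1 [Ha2 _]], Hb as [Hb1 [Hb2 _]].
  split; [apply jet_lincomb; assumption|]. split; [apply periodic_lincomb; assumption|].
  exists ((Rabs c + Rabs d + 1) * L). split; [|apply geometric_lincomb; assumption].
  pose proof (Rabs_pos c). pose proof (Rabs_pos d). nra.
Qed.

Lemma good_Dinv (x0 : R) (a : jets) : good a -> good (Dinv x0 a).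
Proof.
  intros [Ha1 [Ha2 [L [HL H]]]].
  split; [apply jet_Dinv; assumption|]. split; [apply periodic_Dinv; assumption|].
  exists (2 * L). split; [lra|apply geometric_Dinv; assumption].
Qed.

Lemma good_pow_jets (a : jets) (p : nat) : good a -> good (pow_jets a p).
Proof.
  intros Ha. induction p as [|p IH]; simpl; [|apply good_conv; assumption].
  split; [apply jet_one_jets|]. split; [intros n k x; reflexivity|].
  exists 1. split; [lra|apply geometric_one_jets].
Qed.

Definition source_jets (p : nat) (a : jets) : jets := conv (Dx (pow_jets a p)) (Dx a).

(** Jets of the right-hand side of the equation solved for the time
    derivative. *)
Definition rhs_jets (x0 : R) (p : nat) (a : jets) : jets :=
  lincomb (-1) (conv (pow_jets a p) (Dx a)) (/ 2) (Dinv x0 (source_jets p a)).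

Lemma good_source_jets (p : nat) (a : jets) : good a -> good (source_jets p a).
Proof. intros Ha. apply good_conv; apply good_Dx; [apply good_pow_jets|]; exact Ha. Qed.

Lemma good_rhs_jets (x0 : R) (p : nat) (a : jets) : good a -> good (rhs_jets x0 p a).
Proof.
  intros Ha. apply good_lincomb.
  - apply good_conv; [apply good_pow_jets|apply good_Dx]; exact Ha.
  - apply good_Dinv, good_source_jets, Ha.
Qed.

(** * Majorants *)

(** Summable weights that a Cauchy product reproduces up to a constant, see
    [inv_square_conv]. *)
Definition inv_square (N : nat) : R := / (INR (S N)) ^ 2.

Lemma inv_square_pos (N : nat) : 0 < inv_square N.
Proof. unfold inv_square. apply Rinv_0_lt_compat, pow_lt, lt_0_INR. lia. Qed.

Lemma inv_square_le_1 (N : nat) : inv_square N <= 1.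
Proof.
  unfold inv_square. rewrite <- Rinv_1. apply Rinv_le_contravar; [lra|].
  rewrite <- (pow1 2). apply pow_incr. split; [lra|]. rewrite S_INR. pose proof (pos_INR N). lra.
Qed.

Lemma inv_square_step (N : nat) : inv_square N <= 4 * inv_square (S N).
Proof.
  unfold inv_square. rewrite (S_INR (S N)). set (y := INR (S N)).
  assert (Hy : 1 <= y) by (unfold y; rewrite S_INR; pose proof (pos_INR N); lra).
  apply Rmult_le_reg_l with (y ^ 2 * (y + 1) ^ 2); [nra|].
  replace (y ^ 2 * (y + 1) ^ 2 * / y ^ 2) with ((y + 1) ^ 2) by (field; lra).
  replace (y ^ 2 * (y + 1) ^ 2 * (4 * / (y + 1) ^ 2)) with (4 * y ^ 2) by (field; lra).
  nra.
Qed.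

Lemma inv_square_sum (N : nat) : sum_f_R0 inv_square N <= 2 - / INR (S N).
Proof.
  induction N as [|N IH].
  - unfold inv_square. simpl. lra.
  - rewrite tech5. unfold inv_square at 2. rewrite (S_INR (S N)).
    set (y := INR (S N)) in *.
    assert (Hy : 1 <= y) by (unfold y; rewrite S_INR; pose proof (pos_INR N); lra).
    assert (H : / (y + 1) ^ 2 <= / y - / (y + 1)); [|lra].
    replace (/ y - / (y + 1)) with (/ (y * (y + 1))) by (field; lra).
    apply Rinv_le_contravar; nra.
Qed.

(** For p + q = N + 2 one has 1/(p q) = (1/p + 1/q) / (N + 2). Squaring this
    leaves, up to the factor (N + 2)^-2, sums of inverse squares, which are at
    most 2. *)
Lemma inv_square_conv (N : nat) : sum_f_R0 (fun m => inv_square m * inv_square (N - m)) N <= 8 * inv_square N.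
Proof.
  set (z := INR (S (S N))).
  assert (Hz : 1 <= z) by (unfold z; rewrite !S_INR; pose proof (pos_INR N); lra).
  assert (H : forall m, (m <= N)%nat ->
    inv_square m * inv_square (N - m) <= (inv_square m + inv_square (N - m)) * (2 * / z ^ 2)).
  { intros m Hm. unfold inv_square.
    assert (Hpq : z = INR (S m) + INR (S (N - m))).
    { unfold z. rewrite <- plus_INR. f_equal. lia. }
    rewrite Hpq. clear Hpq.
    assert (Hp : 0 < INR (S m)) by (apply lt_0_INR; lia).
    assert (Hq : 0 < INR (S (N - m))) by (apply lt_0_INR; lia).
    set (p := INR (S m)) in *. set (q := INR (S (N - m))) in *. clearbody p q.
    assert (Hpq : 0 < p * q) by nra.
    apply Rmult_le_reg_l with ((p ^ 2 * q ^ 2) * (p + q) ^ 2).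
    - apply Rmult_lt_0_compat; [apply Rmult_lt_0_compat|]; apply pow_lt; lra.
    - replace (p ^ 2 * q ^ 2 * (p + q) ^ 2 * (/ p ^ 2 * / q ^ 2)) with ((p + q) ^ 2)
        by (field; lra).
      replace (p ^ 2 * q ^ 2 * (p + q) ^ 2 * ((/ p ^ 2 + / q ^ 2) * (2 * / (p + q) ^ 2)))
        with (2 * (p ^ 2 + q ^ 2)) by (field; lra).
      pose proof (pow2_ge_0 (p - q)). nra. }
  eapply Rle_trans; [apply sum_Rle, H|].
  rewrite <- scal_sum, plus_sum, sum_f_R0_skip.
  assert (Hs : sum_f_R0 inv_square N <= 2).
  { pose proof (inv_square_sum N). assert (0 < / INR (S N)) by (apply Rinv_0_lt_compat, lt_0_INR; lia). lra. }
  assert (Hz2 : / z ^ 2 <= inv_square N).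
  { unfold inv_square. apply Rinv_le_contravar; [apply pow_lt, lt_0_INR; lia|].
    apply pow_incr. split; [apply pos_INR|]. unfold z. rewrite (S_INR (S N)). lra. }
  assert (0 < / z ^ 2) by (apply Rinv_0_lt_compat, pow_lt; lra). nra.
Qed.

(** The coefficient of h^k t^n in (Q h + l t)^(n + k). *)
Definition linpow (Q l : R) (n k : nat) : R := binom (n + k) k * Q ^ k * l ^ n.

(** Majorisation by c Psi (Q h + l t), where Psi has coefficients 1/(N+1)^2. *)
Definition majorized (Q l c : R) (a : jets) : Prop :=
  forall n k x, Rabs (a n k x) <= c * (inv_square (n + k) * linpow Q l n k).

(** Majorisation by c Phi (Q h + l t), where Phi has coefficients 1/(N+1)^3.
    The additional factor pays for one derivative. *)
Definition strongly_majorized (Q l c : R) (a : jets) : Prop :=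
  forall n k x, Rabs (a n k x) <= c * (inv_square (n + k) / INR (S (n + k)) * linpow Q l n k).

Lemma linpow_nonneg (Q l : R) (n k : nat) : 0 <= Q -> 0 <= l -> 0 <= linpow Q l n k.
Proof.
  intros HQ Hl. unfold linpow.
  repeat apply Rmult_le_pos; try apply pow_le; try assumption. apply binom_nonneg.
Qed.

Lemma sum_shift_le (F : nat -> R) (n j N : nat) :
  (forall m, 0 <= F m) -> (n + j <= N)%nat ->
  sum_f_R0 (fun i => F (j + i)%nat) n <= sum_f_R0 F N.
Proof.
  revert F N. induction j as [|j IH]; intros F N HF HN.
  - change (sum_f_R0 F n <= sum_f_R0 F N). induction N as [|N IHN].
    + replace n with 0%nat by lia. simpl. lra.
    + destruct (Nat.eq_dec n (S N)) as [->|Hne]; [apply Rle_refl|].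
      rewrite tech5. specialize (IHN ltac:(lia)). specialize (HF (S N)). lra.
  - destruct N as [|N]; [lia|]. rewrite sum_first.
    pose proof (IH (fun m => F (S m)) N (fun m => HF (S m)) ltac:(lia)) as H.
    specialize (HF 0%nat).
    change (sum_f_R0 (fun i => F (S (j + i))) n <= F 0%nat + sum_f_R0 (fun m => F (S m)) N).
    lra.
Qed.

(** On each diagonal i + j = m Vandermonde's identity sums the products of
    binomial coefficients to a single one. What remains is the Cauchy product
    of the weights. *)
Lemma linpow_conv (Q l : R) (n k : nat) :
  0 <= Q -> 0 <= l ->
  sum_f_R0 (fun i => sum_f_R0 (fun j =>
    (inv_square (i + j) * linpow Q l i j) * (inv_square ((n - i) + (k - j)) * linpow Q l (n - i) (k - j))) k) n
  <= 8 * (inv_square (n + k) * linpow Q l n k).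
Proof.
  intros HQ Hl.
  set (g := fun j m => (inv_square m * inv_square (n + k - m)) * (binom m j * binom (n + k - m) (k - j))).
  assert (Hg : forall j m, 0 <= g j m).
  { intros j m. unfold g. pose proof (inv_square_pos m). pose proof (inv_square_pos (n + k - m)).
    repeat apply Rmult_le_pos; try apply binom_nonneg; lra. }
  set (c := Q ^ k * l ^ n).
  assert (Hc : 0 <= c) by (apply Rmult_le_pos; apply pow_le; assumption).
  apply Rle_trans with (c * sum_f_R0 (fun j => sum_f_R0 (g j) (n + k)) k).
  - rewrite sum_swap, scal_sum. apply sum_Rle. intros j Hj.
    apply Rle_trans with (sum_f_R0 (fun i => g j (j + i)%nat) n * c).
    + rewrite Rmult_comm, scal_sum. apply Req_le, sum_eq. intros i Hi.
      unfold g, c, linpow.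
      replace (n + k - (j + i))%nat with (n - i + (k - j))%nat by lia.
      rewrite (Nat.add_comm j i).
      replace (Q ^ k) with (Q ^ j * Q ^ (k - j)) by (rewrite <- pow_add; f_equal; lia).
      replace (l ^ n) with (l ^ i * l ^ (n - i)) by (rewrite <- pow_add; f_equal; lia).
      ring.
    + apply Rmult_le_compat_r; [exact Hc|].
      apply sum_shift_le; [apply Hg|lia].
  - rewrite sum_swap.
    rewrite (sum_eq _ (fun m => inv_square m * inv_square (n + k - m) * binom (n + k) k)).
    + rewrite <- scal_sum. unfold linpow. pose proof (inv_square_conv (n + k)) as H.
      fold c. replace (8 * (inv_square (n + k) * (binom (n + k) k * Q ^ k * l ^ n)))
        with (c * (binom (n + k) k * (8 * inv_square (n + k)))) by (unfold c; ring).
      apply Rmult_le_compat_l; [exact Hc|]. apply Rmult_le_compat_l; [apply binom_nonneg|exact H].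
    + intros m Hm. unfold g.
      rewrite (sum_eq _ (fun j => binom m j * binom (n + k - m) (k - j) * (inv_square m * inv_square (n + k - m))))
        by (intros; ring).
      rewrite <- scal_sum, Vandermonde. f_equal. f_equal. lia.
Qed.

Lemma majorized_conv (Q l c d : R) (a b : jets) :
  0 <= Q -> 0 <= l -> majorized Q l c a -> majorized Q l d b -> majorized Q l (8 * c * d) (conv a b).
Proof.
  intros HQ Hl Ha Hb n k x. unfold conv.
  assert (Hcd : 0 <= c * d).
  { pose proof (Ha 0%nat 0%nat 0) as H1. pose proof (Hb 0%nat 0%nat 0) as H2.
    pose proof (Rabs_pos (a 0%nat 0%nat 0)). pose proof (Rabs_pos (b 0%nat 0%nat 0)).
    unfold inv_square, linpow in H1, H2. simpl in H1, H2.
    replace (c * (/ (1 * (1 * 1)) * (1 * 1 * 1))) with c in H1 by field.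
    replace (d * (/ (1 * (1 * 1)) * (1 * 1 * 1))) with d in H2 by field.
    apply Rmult_le_pos; lra. }
  replace (8 * c * d * (inv_square (n + k) * linpow Q l n k))
    with (c * d * (8 * (inv_square (n + k) * linpow Q l n k))) by ring.
  eapply Rle_trans; [|apply Rmult_le_compat_l; [exact Hcd|apply linpow_conv; assumption]].
  rewrite scal_sum. eapply Rle_trans; [apply sum_f_R0_triangle|].
  apply sum_Rle. intros i Hi.
  rewrite Rmult_comm, scal_sum. eapply Rle_trans; [apply sum_f_R0_triangle|].
  apply sum_Rle. intros j Hj. rewrite Rabs_mult.
  replace (inv_square (i + j) * linpow Q l i j * (inv_square (n - i + (k - j)) * linpow Q l (n - i) (k - j)) * (c * d))
    with ((c * (inv_square (i + j) * linpow Q l i j)) * (d * (inv_square (n - i + (k - j)) * linpow Q l (n - i) (k - j))))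
    by ring.
  apply Rmult_le_compat; try apply Rabs_pos; [apply Ha|apply Hb].
Qed.

Lemma majorized_weaken (Q l c d : R) (a : jets) :
  0 <= Q -> 0 <= l -> c <= d -> majorized Q l c a -> majorized Q l d a.
Proof.
  intros HQ Hl Hcd Ha n k x. eapply Rle_trans; [apply Ha|].
  apply Rmult_le_compat_r; [|exact Hcd].
  apply Rmult_le_pos; [left; apply inv_square_pos|apply linpow_nonneg; assumption].
Qed.

Lemma majorized_lincomb (Q l c d s t : R) (a b : jets) :
  majorized Q l c a -> majorized Q l d b -> majorized Q l (Rabs s * c + Rabs t * d) (lincomb s a t b).
Proof.
  intros Ha Hb n k x. unfold lincomb. eapply Rle_trans; [apply Rabs_triang|].
  rewrite !Rabs_mult, Rmult_plus_distr_r, !(Rmult_assoc (Rabs _)).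
  apply Rplus_le_compat; apply Rmult_le_compat_l; try apply Rabs_pos; [apply Ha|apply Hb].
Qed.

Lemma majorized_one_jets (Q l : R) : 0 <= Q -> 0 <= l -> majorized Q l 1 one_jets.
Proof.
  intros HQ Hl n k x.
  assert (0 <= inv_square (n + k) * linpow Q l n k)
    by (apply Rmult_le_pos; [left; apply inv_square_pos|apply linpow_nonneg; assumption]).
  destruct n, k; unfold one_jets; rewrite ?Rabs_R0, ?Rabs_R1; try lra.
  unfold inv_square, linpow. simpl. lra.
Qed.

(** Integration in h divides the coefficient of order k by k + 1, and by
    [binom_absorb] the binomial coefficient drops by no more than that. The
    coefficient of order 0 is at most twice the sup norm of the integrand. *)
Lemma majorized_Dinv (x0 Q l c : R) (a : jets) :
  1 <= Q -> 0 <= l -> jet a -> periodic_jets a ->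
  majorized Q l c a -> majorized Q l (8 * c) (Dinv x0 a).
Proof.
  intros HQ Hl Hj Hp Ha n k x.
  assert (Hpos : forall n k, 0 <= c * (inv_square (n + k) * linpow Q l n k)).
  { intros n' k'. eapply Rle_trans; [apply Rabs_pos|apply (Ha n' k' 0)]. }
  destruct k as [|k].
  - eapply Rle_trans; [apply (Dinv_0_bound x0 a n (c * (inv_square (n + 0) * linpow Q l n 0))); try assumption|].
    + intros y. apply Ha.
    + specialize (Hpos n 0%nat). lra.
  - eapply Rle_trans; [apply (Dinv_S_bound x0 a n k (c * (inv_square (n + k) * linpow Q l n k))); try assumption|].
    + intros y. apply Ha.
    + assert (Hc : 0 <= c).
      { specialize (Hpos 0%nat 0%nat). unfold inv_square, linpow in Hpos. simpl in Hpos.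
        replace (c * (/ (1 * (1 * 1)) * (1 * 1 * 1))) with c in Hpos by field. exact Hpos. }
      unfold linpow. replace (n + S k)%nat with (S (n + k)) by lia.
      assert (HK : 0 < INR (S k)) by (apply lt_0_INR; lia).
      assert (H1 : binom (n + k) k / INR (S k) <= binom (S (n + k)) (S k)).
      { apply Rmult_le_reg_l with (INR (S k)); [exact HK|]. rewrite binom_absorb.
        replace (INR (S k) * (binom (n + k) k / INR (S k))) with (1 * binom (n + k) k) by (field; lra).
        apply Rmult_le_compat_r; [apply binom_nonneg|]. rewrite S_INR. pose proof (pos_INR (n + k)). lra. }
      pose proof (inv_square_step (n + k)) as H2. pose proof (inv_square_pos (n + k)) as H3.
      assert (H4 : Q ^ k <= Q ^ S k) by (apply Rle_pow; [lra|lia]).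
      assert (H5 : 0 <= Q ^ k) by (apply pow_le; lra).
      assert (H6 : 0 <= l ^ n) by (apply pow_le; lra).
      assert (H7 : 0 <= binom (n + k) k / INR (S k))
        by (apply Rmult_le_pos; [apply binom_nonneg|left; apply Rinv_0_lt_compat, HK]).
      replace (2 * (c * (inv_square (n + k) * (binom (n + k) k * Q ^ k * l ^ n))) / INR (S k))
        with ((2 * c) * (inv_square (n + k) * (binom (n + k) k / INR (S k) * Q ^ k * l ^ n))) by (field; lra).
      replace (8 * c * (inv_square (S (n + k)) * (binom (S (n + k)) (S k) * Q ^ S k * l ^ n)))
        with ((2 * c) * ((4 * inv_square (S (n + k))) * (binom (S (n + k)) (S k) * Q ^ S k * l ^ n))) by ring.
      apply Rmult_le_compat_l; [lra|].
      apply Rmult_le_compat; [lra| |exact H2|].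
      * apply Rmult_le_pos; [apply Rmult_le_pos|]; assumption.
      * apply Rmult_le_compat_r; [exact H6|]. apply Rmult_le_compat; assumption.
Qed.

Lemma strongly_majorized_weaken (Q l c : R) (a : jets) :
  0 <= c -> 0 <= Q -> 0 <= l -> strongly_majorized Q l c a -> majorized Q l c a.
Proof.
  intros Hc HQ Hl Ha n k x. eapply Rle_trans; [apply Ha|].
  apply Rmult_le_compat_l; [exact Hc|]. apply Rmult_le_compat_r; [apply linpow_nonneg; assumption|].
  pose proof (inv_square_pos (n + k)) as H. rewrite <- (Rmult_1_r (inv_square (n + k))) at 2.
  apply Rmult_le_compat_l; [lra|]. rewrite <- Rinv_1. apply Rinv_le_contravar; [lra|].
  rewrite S_INR. pose proof (pos_INR (n + k)). lra.
Qed.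

(** Differentiation in h multiplies the weight of degree N + 1 by N + 1, and
    (N + 1) / (N + 2)^3 is at most 1 / (N + 1)^2. *)
Lemma strongly_majorized_Dx (Q l c : R) (a : jets) :
  0 <= c -> 0 <= Q -> 0 <= l -> strongly_majorized Q l c a -> majorized Q l (c * Q) (Dx a).
Proof.
  intros Hc HQ Hl Ha n k x. unfold Dx. rewrite Rabs_mult, Rabs_pos_eq by apply pos_INR.
  eapply Rle_trans; [apply Rmult_le_compat_l; [apply pos_INR|apply Ha]|].
  unfold linpow. replace (n + S k)%nat with (S (n + k)) by lia.
  pose proof (binom_absorb (n + k) k) as H1.
  replace (INR (S k) * (c * (inv_square (S (n + k)) / INR (S (S (n + k))) *
      (binom (S (n + k)) (S k) * Q ^ S k * l ^ n))))
    with ((c * Q * (Q ^ k * l ^ n)) * (inv_square (S (n + k)) / INR (S (S (n + k))) *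
      (INR (S k) * binom (S (n + k)) (S k)))) by (simpl pow; unfold Rdiv; ring).
  rewrite H1.
  replace (c * Q * (inv_square (n + k) * (binom (n + k) k * Q ^ k * l ^ n)))
    with ((c * Q * (Q ^ k * l ^ n)) * (inv_square (n + k) * binom (n + k) k)) by ring.
  apply Rmult_le_compat_l.
  - repeat apply Rmult_le_pos; try apply pow_le; assumption.
  - rewrite <- Rmult_assoc. apply Rmult_le_compat_r; [apply binom_nonneg|].
    unfold inv_square. rewrite (S_INR (S (n + k))). set (y := INR (S (n + k))).
    assert (Hy : 1 <= y) by (unfold y; rewrite S_INR; pose proof (pos_INR (n + k)); lra).
    apply Rmult_le_reg_l with (y ^ 2 * (y + 1) ^ 3); [apply Rmult_lt_0_compat; apply pow_lt; lra|].
    replace (y ^ 2 * (y + 1) ^ 3 * (/ (y + 1) ^ 2 / (y + 1) * y)) with (y ^ 3) by (field; lra).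
    replace (y ^ 2 * (y + 1) ^ 3 * / y ^ 2) with ((y + 1) ^ 3) by (field; lra).
    apply pow_incr. lra.
Qed.

Lemma majorized_pow_jets (Q l c : R) (a : jets) (p : nat) :
  0 <= Q -> 0 <= l -> majorized Q l c a -> majorized Q l ((8 * c) ^ p) (pow_jets a p).
Proof.
  intros HQ Hl Ha. induction p as [|p IH]; simpl.
  - apply majorized_one_jets; assumption.
  - apply majorized_conv; assumption.
Qed.

(** A power of u is only known to be majorised by Psi, whose derivative is too
    large. The Leibniz rule differentiates single factors, for which a bound is
    at hand. The constant e must not depend on l, which is chosen after it. *)
Lemma majorized_Dx_pow_jets (Q c d : R) (p : nat) :
  0 <= Q -> exists e, forall l a, 0 <= l ->
  majorized Q l c a -> majorized Q l d (Dx a) -> majorized Q l e (Dx (pow_jets a p)).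
Proof.
  intros HQ. induction p as [|p [e IH]].
  - exists 0. intros l a Hl _ _ n k x. simpl pow_jets. unfold Dx.
    replace (INR (S k) * one_jets n (S k) x) with 0 by (destruct n; unfold one_jets; ring).
    rewrite Rabs_R0. lra.
  - exists (8 * d * (8 * c) ^ p + 8 * c * e). intros l a Hl Ha Hd n k x.
    simpl pow_jets. rewrite Dx_conv. eapply Rle_trans; [apply Rabs_triang|].
    rewrite Rmult_plus_distr_r. apply Rplus_le_compat.
    + apply majorized_conv; try assumption. apply majorized_pow_jets; assumption.
    + apply majorized_conv; try assumption. apply IH; assumption.
Qed.

Lemma jet_periodic_pow_jets (a : jets) (p : nat) :
  jet a -> periodic_jets a -> jet (pow_jets a p) /\ periodic_jets (pow_jets a p).
Proof.
  intros Hj Hp. induction p as [|p [IH1 IH2]]; simpl.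
  - split; [apply jet_one_jets|intros n k x; reflexivity].
  - split; [apply jet_conv|apply periodic_conv]; assumption.
Qed.

Lemma majorized_rhs_jets (x0 Q c : R) (p : nat) :
  1 <= Q -> 0 <= c -> exists e, 0 <= e /\ forall l a, 0 <= l -> jet a -> periodic_jets a ->
  strongly_majorized Q l c a -> majorized Q l e (rhs_jets x0 p a).
Proof.
  intros HQ Hc.
  destruct (majorized_Dx_pow_jets Q c (c * Q) p ltac:(lra)) as [e He].
  exists (Rmax 0 (Rabs (-1) * (8 * (8 * c) ^ p * (c * Q)) + Rabs (/ 2) * (8 * (8 * e * (c * Q))))).
  split; [apply Rmax_l|]. intros l a Hl Hj Hp Ha.
  pose proof (strongly_majorized_weaken Q l c a Hc ltac:(lra) Hl Ha) as H1.
  pose proof (strongly_majorized_Dx Q l c a Hc ltac:(lra) Hl Ha) as H2.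
  destruct (jet_periodic_pow_jets a p Hj Hp) as [Hfp1 Hfp2].
  eapply majorized_weaken; [lra|exact Hl|apply Rmax_r|].
  apply majorized_lincomb.
  - apply majorized_conv; try assumption; [lra|]. apply majorized_pow_jets; try assumption. lra.
  - apply majorized_Dinv; try assumption.
    + apply jet_conv; apply jet_Dx; assumption.
    + apply periodic_conv; apply periodic_Dx; assumption.
    + apply majorized_conv; try assumption; [lra|]. apply He; assumption.
Qed.

(** Integration in t restores the factor of degree lost by one derivative and
    divides by l, so a large l absorbs the constant e of the integrand. *)
Lemma majorized_integrate (Q l c e y : R) (n k : nat) :
  0 <= Q -> 0 <= e -> 8 * e <= c * l -> 0 <= l ->
  Rabs y <= e * (inv_square (n + k) * linpow Q l n k) ->
  Rabs (y / INR (S n)) <= c * (inv_square (S n + k) / INR (S (S n + k)) * linpow Q l (S n) k).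
Proof.
  intros HQ He Hle Hl Hy. unfold Rdiv at 1. rewrite Rabs_mult.
  assert (Hn : 0 < INR (S n)) by (apply lt_0_INR; lia).
  rewrite (Rabs_pos_eq (/ _)) by (left; apply Rinv_0_lt_compat, Hn).
  apply Rmult_le_reg_r with (INR (S n)); [exact Hn|].
  rewrite Rmult_assoc, Rinv_l, Rmult_1_r by lra.
  eapply Rle_trans; [exact Hy|]. unfold linpow.
  pose proof (binom_absorb_up n k) as H1.
  replace (c * (inv_square (S n + k) / INR (S (S n + k)) * (binom (S n + k) k * Q ^ k * l ^ S n)) * INR (S n))
    with ((c * l) * (inv_square (S n + k) / INR (S (S n + k)) * (INR (S n) * binom (S n + k) k * (Q ^ k * l ^ n))))
    by (simpl pow; unfold Rdiv; ring).
  rewrite H1. change (S n + k)%nat with (S (n + k)).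
  assert (H2 : inv_square (n + k) <= 8 * (inv_square (S (n + k)) / INR (S (S (n + k))) * INR (S (n + k)))).
  { eapply Rle_trans; [apply inv_square_step|].
    rewrite (S_INR (S (n + k))). set (z := INR (S (n + k))).
    assert (Hz : 1 <= z) by (unfold z; rewrite S_INR; pose proof (pos_INR (n + k)); lra).
    pose proof (inv_square_pos (S (n + k))) as H.
    apply Rmult_le_reg_r with (z + 1); [lra|].
    replace (8 * (inv_square (S (n + k)) / (z + 1) * z) * (z + 1)) with (inv_square (S (n + k)) * (8 * z)) by (field; lra).
    nra. }
  set (w := binom (n + k) k * (Q ^ k * l ^ n)).
  assert (Hw : 0 <= w).
  { unfold w. repeat apply Rmult_le_pos; try apply pow_le; try assumption. apply binom_nonneg. }
  set (r := inv_square (S (n + k)) / INR (S (S (n + k))) * INR (S (n + k))) in *.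
  replace (e * (inv_square (n + k) * (binom (n + k) k * Q ^ k * l ^ n))) with (e * inv_square (n + k) * w)
    by (unfold w; ring).
  replace (c * l * (inv_square (S (n + k)) / INR (S (S (n + k))) * (INR (S (n + k)) * binom (n + k) k * (Q ^ k * l ^ n))))
    with (c * l * r * w) by (unfold w, r; ring).
  apply Rmult_le_compat_r; [exact Hw|].
  pose proof (inv_square_pos (n + k)). nra.
Qed.

Lemma strongly_majorized_geometric (Q l c : R) (a : jets) :
  0 <= c -> 0 <= Q -> 0 <= l -> strongly_majorized Q l c a -> exists L, 1 <= L /\ geometric L a.
Proof.
  intros Hc HQ Hl Ha. exists (c + 2 * Q + 2 * l + 1). split; [lra|].
  set (L := c + 2 * Q + 2 * l + 1). intros n k x.
  eapply Rle_trans; [apply (strongly_majorized_weaken Q l c a Hc HQ Hl Ha)|].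
  pose proof (inv_square_le_1 (n + k)) as H1. pose proof (inv_square_pos (n + k)) as H2.
  pose proof (linpow_nonneg Q l n k HQ Hl) as H3.
  replace (n + k + 1)%nat with (1 + (n + k))%nat by lia.
  rewrite pow_add, pow_1. apply Rmult_le_compat; [exact Hc| |unfold L; lra|].
  - apply Rmult_le_pos; lra.
  - apply Rle_trans with (linpow Q l n k); [nra|].
    unfold linpow. apply Rle_trans with (2 ^ (n + k) * Q ^ k * l ^ n).
    + apply Rmult_le_compat_r; [apply pow_le, Hl|]. apply Rmult_le_compat_r; [apply pow_le, HQ|].
      apply binom_le_pow.
    + rewrite !pow_add.
      replace (2 ^ n * 2 ^ k * Q ^ k * l ^ n) with ((2 ^ n * l ^ n) * (2 ^ k * Q ^ k)) by ring.
      rewrite <- !Rpow_mult_distr.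
      apply Rmult_le_compat; try (apply pow_le; lra); apply pow_incr; unfold L; lra.
Qed.

(** * Sums of jets *)

Lemma is_lim_seq_geom_bound (u : nat -> R) (l M q : R) :
  0 <= q < 1 -> (forall n, Rabs (u n - l) <= M * q ^ n) -> is_lim_seq u l.
Proof.
  intros Hq H.
  apply (is_lim_seq_ext (fun n => (u n - l) + l)); [intros; ring|].
  replace (Finite l) with (Finite (0 + l)) by (f_equal; ring).
  apply is_lim_seq_plus'; [|apply is_lim_seq_const].
  apply is_lim_seq_abs_0.
  apply (is_lim_seq_le_le (fun _ => 0) _ (fun n => M * q ^ n)).
  - intros n. split; [apply Rabs_pos|apply H].
  - apply is_lim_seq_const.
  - replace (Finite 0) with (Rbar_mult M 0) by (simpl; f_equal; ring).
    apply is_lim_seq_scal_l, is_lim_seq_geom. rewrite Rabs_pos_eq; lra.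
Qed.

(** The y-derivative of the sum over k <= K of f_k(y) (z - y)^k telescopes to
    its last term. The mean value theorem between x and z = x + h then bounds the
    Taylor remainder. *)
Lemma jet_Taylor (f : nat -> R -> R) (M L x h : R) :
  (forall k y, is_derive (f k) y (INR (S k) * f (S k) y)) ->
  (forall k y, Rabs (f k y) <= M * L ^ k) -> 0 < L -> 2 * L * Rabs h < 1 ->
  f 0%nat (x + h) = PSeries (fun k => f k x) h.
Proof.
  intros Hd Hb HL Hh. symmetry. apply is_series_unique.
  set (z := x + h).
  set (g := fun K y => sum_f_R0 (fun k => f k y * (z - y) ^ k) K).
  assert (Hg : forall K y, is_derive (g K) y (INR (S K) * f (S K) y * (z - y) ^ K)).
  { induction K as [|K IH]; intros y.
    - apply (is_derive_ext (f 0%nat)); [intros; unfold g; simpl; ring|].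
      replace (INR 1 * f 1%nat y * (z - y) ^ 0) with (INR 1 * f 1%nat y) by (simpl; ring).
      apply Hd.
    - replace (INR (S (S K)) * f (S (S K)) y * (z - y) ^ S K) with
        (plus (INR (S K) * f (S K) y * (z - y) ^ K)
          (plus (mult (INR (S (S K)) * f (S (S K)) y) ((z - y) ^ S K))
             (mult (f (S K) y) (INR (S K) * (0 - 1) * (z - y) ^ K))))
        by (unfold plus, mult; simpl; ring).
      apply (is_derive_plus (g K) (fun y => f (S K) y * (z - y) ^ S K) y); [apply IH|].
      apply (is_derive_mult (K := R_AbsRing) (f (S K)) (fun y => (z - y) ^ S K)).
      + apply Hd.
      + apply (is_derive_pow (fun y => z - y) (S K) y (0 - 1)). auto_derive; [exact I|ring].
      + intros; apply Rmult_comm. }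
  change (is_lim_seq (sum_n (fun k => f k x * h ^ k)) (f 0%nat z)).
  assert (HM : 0 <= M).
  { specialize (Hb 0%nat 0). pose proof (Rabs_pos (f 0%nat 0)). simpl in Hb. lra. }
  pose proof (Rabs_pos h) as Hh0.
  assert (Hq : 0 <= 2 * L * Rabs h) by (apply Rmult_le_pos; lra).
  apply (is_lim_seq_geom_bound _ _ M (2 * L * Rabs h)); [lra|].
  intros K. rewrite sum_n_Reals.
  replace (sum_f_R0 (fun k => f k x * h ^ k) K) with (g K x).
  2:{ unfold g, z. apply sum_eq. intros i _. f_equal. f_equal. ring. }
  assert (Hgz : g K z = f 0%nat z).
  { unfold g. clear. induction K as [|K IH]; simpl; [ring|]. rewrite IH. ring. }
  rewrite <- Hgz, Rabs_minus_sym.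
  destruct (MVT_gen (g K) x z (fun y => INR (S K) * f (S K) y * (z - y) ^ K)) as [c [Hc He]].
  - intros; apply Hg.
  - intros. apply continuity_pt_filterlim, (continuous_of_derive _ _ (Hg K)).
  - rewrite He, !Rabs_mult, <- RPow_abs, (Rabs_pos_eq (INR _)) by apply pos_INR.
    assert (Hzc : Rabs (z - c) <= Rabs h).
    { unfold z in *. unfold Rmin, Rmax in Hc.
      destruct (Rle_dec x (x + h)); unfold Rabs; destruct (Rcase_abs (x + h - c)), (Rcase_abs h); lra. }
    replace (z - x) with h by (unfold z; ring).
    apply Rle_trans with (2 ^ K * (M * L ^ S K) * Rabs h ^ K * Rabs h).
    + apply Rmult_le_compat_r; [exact Hh0|].
      apply Rmult_le_compat.
      * apply Rmult_le_pos; [apply pos_INR|apply Rabs_pos].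
      * apply pow_le, Rabs_pos.
      * apply Rmult_le_compat; [apply pos_INR|apply Rabs_pos|apply INR_S_le_pow2|apply Hb].
      * apply pow_incr. split; [apply Rabs_pos|exact Hzc].
    + rewrite !Rpow_mult_distr.
      replace (2 ^ K * (M * L ^ S K) * Rabs h ^ K * Rabs h)
        with (M * (2 ^ K * L ^ K * Rabs h ^ K) * (L * Rabs h)) by (simpl; ring).
      rewrite <- (Rmult_1_r (M * (2 ^ K * L ^ K * Rabs h ^ K))) at 2.
      apply Rmult_le_compat_l; [|nra].
      repeat apply Rmult_le_pos; try apply pow_le; lra.
Qed.

Definition series_val (a : jets) (x t : R) : R := PSeries (fun n => a n 0%nat x) t.

Definition small_time (P : R -> Prop) : Prop :=
  exists L, 1 <= L /\ forall t, L * Rabs t < 1 -> P t.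

Lemma small_time_mono (P Q : R -> Prop) :
  (forall t, P t -> Q t) -> small_time P -> small_time Q.
Proof. intros H [L [HL HP]]. exists L. split; [exact HL|]. intros t Ht. apply H, HP, Ht. Qed.

Lemma small_time_and (P Q : R -> Prop) :
  small_time P -> small_time Q -> small_time (fun t => P t /\ Q t).
Proof.
  intros [L [HL HP]] [L' [HL' HQ]]. exists (Rmax L L').
  pose proof (Rmax_l L L') as H1. pose proof (Rmax_r L L') as H2.
  split; [lra|]. intros t Ht. pose proof (Rabs_pos t).
  split; [apply HP|apply HQ]; nra.
Qed.

Lemma small_time_locally (P : R -> Prop) : small_time P -> locally 0 P.
Proof.
  intros [L [HL HP]].
  assert (H : 0 < / L) by (apply Rinv_0_lt_compat; lra).
  exists (mkposreal _ H). intros t Ht. apply HP.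
  change (Rabs (t - 0) < / L) in Ht. rewrite Rminus_0_r in Ht.
  apply (Rmult_lt_compat_l L) in Ht; [|lra]. rewrite Rinv_r in Ht; lra.
Qed.

Lemma geometric_row (L : R) (a : jets) (k : nat) (x : R) (n : nat) :
  geometric L a -> Rabs (a n k x) <= L ^ (k + 1) * L ^ n.
Proof.
  intros Ha. rewrite <- pow_add. replace (k + 1 + n)%nat with (n + k + 1)%nat by lia. apply Ha.
Qed.

Lemma geometric_radius (L : R) (a : jets) (k : nat) (x t : R) :
  1 <= L -> geometric L a -> L * Rabs t < 1 ->
  Rbar_lt (Rabs t) (CV_radius (fun n => a n k x)).
Proof.
  intros HL Ha Ht. apply (lt_CV_radius_geom _ (L ^ (k + 1)) L); [lra| |exact Ht].
  intros n. apply geometric_row, Ha.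
Qed.

Lemma geometric_ex (L : R) (a : jets) (k : nat) (x t : R) :
  1 <= L -> geometric L a -> L * Rabs t < 1 -> ex_pseries (fun n => a n k x) t.
Proof. intros. apply CV_radius_inside, (geometric_radius L); assumption. Qed.

(** Expand each coefficient by [jet_Taylor] and exchange the sums over n and
    k. *)
Lemma series_val_expand (L : R) (a : jets) (x h t : R) :
  1 <= L -> jet a -> geometric L a -> L * Rabs t < 1 -> 2 * L * Rabs h < 1 ->
  series_val a (x + h) t = PSeries (fun k => PSeries (fun n => a n k x) t) h.
Proof.
  intros HL Hj Ha Ht Hh. unfold series_val, PSeries at 1.
  pose proof (Rabs_pos t) as Ht0. pose proof (Rabs_pos h) as Hh0.
  rewrite (Series_ext _ (fun n => Series (fun k => a n k x * h ^ k * t ^ n))).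
  - rewrite Series_swap.
    + unfold PSeries. apply Series_ext. intros k. rewrite <- Series_scal_r.
      apply Series_ext. intros n. ring.
    + apply (summable2_geom _ L (L * Rabs t) (L * Rabs h)); [nra|nra|].
      intros n k. rewrite !Rabs_mult, <- !RPow_abs, !Rpow_mult_distr.
      replace (L * (L ^ n * Rabs t ^ n) * (L ^ k * Rabs h ^ k))
        with (L ^ (n + k + 1) * Rabs h ^ k * Rabs t ^ n) by (rewrite !pow_add; ring).
      apply Rmult_le_compat_r; [apply pow_le, Ht0|].
      apply Rmult_le_compat_r; [apply pow_le, Hh0|]. apply Ha.
  - intros n. rewrite Series_scal_r. f_equal.
    apply (jet_Taylor (a n) (L ^ (n + 1)) L); [apply Hj| |lra|exact Hh].
    intros k y. rewrite <- pow_add. replace (n + 1 + k)%nat with (n + k + 1)%nat by lia. apply Ha.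
Qed.

Lemma geometric_column_bound (L : R) (a : jets) (x t : R) (k : nat) :
  1 <= L -> geometric L a -> L * Rabs t < 1 ->
  Rabs (PSeries (fun n => a n k x) t) <= L / (1 - L * Rabs t) * L ^ k.
Proof.
  intros HL Ha Ht. pose proof (Rabs_pos t) as Ht0.
  replace (L / (1 - L * Rabs t) * L ^ k) with ((L ^ (k + 1)) / (1 - L * Rabs t))
    by (rewrite pow_add; field; lra).
  rewrite <- Series_geom_scal by nra.
  apply Series_abs_le; [|apply ex_series_geom_scal; nra].
  intros n. rewrite Rabs_mult, <- RPow_abs, Rpow_mult_distr, <- Rmult_assoc.
  apply Rmult_le_compat_r; [apply pow_le, Ht0|apply geometric_row, Ha].
Qed.

Lemma is_derive_PSeries_0 (b : nat -> R) :
  Rbar_lt 0 (CV_radius b) -> is_derive (PSeries b) 0 (b 1%nat).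
Proof.
  intros H. replace (b 1%nat) with (PSeries (PS_derive b) 0).
  - apply is_derive_PSeries. rewrite Rabs_R0. exact H.
  - rewrite PSeries_0. unfold PS_derive. simpl. ring.
Qed.

Lemma is_derive_of_expansion (F : R -> R) (b : nat -> R) (x d : R) :
  0 < d -> Rbar_lt 0 (CV_radius b) ->
  (forall h, Rabs h < d -> F (x + h) = PSeries b h) -> is_derive F x (b 1%nat).
Proof.
  intros Hd Hr HF.
  apply (is_derive_ext_loc (fun y => PSeries b (y - x))).
  - exists (mkposreal d Hd). intros y Hy. change (Rabs (y - x) < d) in Hy.
    rewrite <- HF by exact Hy. f_equal. ring.
  - replace (b 1%nat) with (scal 1 (b 1%nat)) by (unfold scal; simpl; unfold mult; simpl; ring).
    apply (is_derive_comp (PSeries b) (fun y => y - x)).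
    + rewrite Rminus_diag. apply is_derive_PSeries_0, Hr.
    + auto_derive; [exact I|ring].
Qed.

Lemma series_val_derive_x (L : R) (a : jets) (x t : R) :
  1 <= L -> jet a -> geometric L a -> L * Rabs t < 1 ->
  is_derive (fun y => series_val a y t) x (series_val (Dx a) x t).
Proof.
  intros HL Hj Ha Ht.
  replace (series_val (Dx a) x t) with (PSeries (fun n => a n 1%nat x) t).
  2:{ unfold series_val. apply PSeries_ext. intros n. unfold Dx. simpl. ring. }
  apply (is_derive_of_expansion _ (fun k => PSeries (fun n => a n k x) t) x (/ (2 * L))).
  - apply Rinv_0_lt_compat. lra.
  - rewrite <- Rabs_R0. apply (lt_CV_radius_geom _ (L / (1 - L * Rabs t)) L); [lra| |rewrite Rabs_R0; lra].
    intros k. apply geometric_column_bound; assumption.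
  - intros h Hh. apply (series_val_expand L); try assumption.
    apply (Rmult_lt_compat_l (2 * L)) in Hh; [|lra]. rewrite Rinv_r in Hh; lra.
Qed.

Lemma series_val_conv (L : R) (a b : jets) (x t : R) :
  1 <= L -> geometric L a -> geometric L b -> L * Rabs t < 1 ->
  series_val (conv a b) x t = series_val a x t * series_val b x t.
Proof.
  intros HL Ha Hb Ht. unfold series_val.
  rewrite <- PSeries_mult by (apply (geometric_radius L); assumption).
  apply PSeries_ext. intros n. unfold conv, PS_mult. apply sum_eq. intros i _. reflexivity.
Qed.

Lemma series_val_lincomb (L c d : R) (a b : jets) (x t : R) :
  1 <= L -> geometric L a -> geometric L b -> L * Rabs t < 1 ->
  series_val (lincomb c a d b) x t = c * series_val a x t + d * series_val b x t.
Proof.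
  intros HL Ha Hb Ht. unfold series_val.
  rewrite <- !PSeries_scal. rewrite <- PSeries_plus.
  - apply PSeries_ext. intros n. reflexivity.
  - apply ex_pseries_scal; [apply Rmult_comm|apply (geometric_ex L); assumption].
  - apply ex_pseries_scal; [apply Rmult_comm|apply (geometric_ex L); assumption].
Qed.

Lemma series_val_periodic (a : jets) (t : R) : periodic_jets a -> periodic1 (fun x => series_val a x t).
Proof. intros Ha x. unfold series_val. apply PSeries_ext. intros n. apply Ha. Qed.

Lemma good_derive_x (a : jets) :
  good a -> small_time (fun t => forall x, is_derive (fun y => series_val a y t) x (series_val (Dx a) x t)).
Proof.
  intros [Hj [_ [L [HL Ha]]]]. exists L. split; [exact HL|].
  intros t Ht x. apply (series_val_derive_x L); assumption.
Qed.

Lemma good_series_val_conv (a b : jets) :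
  good a -> good b ->
  small_time (fun t => forall x, series_val (conv a b) x t = series_val a x t * series_val b x t).
Proof.
  intros Ha Hb. destruct (good_common a b Ha Hb) as [L [HL [H1 H2]]].
  exists L. split; [exact HL|]. intros t Ht x. apply (series_val_conv L); assumption.
Qed.

Lemma good_series_val_lincomb (c d : R) (a b : jets) :
  good a -> good b ->
  small_time (fun t => forall x, series_val (lincomb c a d b) x t = c * series_val a x t + d * series_val b x t).
Proof.
  intros Ha Hb. destruct (good_common a b Ha Hb) as [L [HL [H1 H2]]].
  exists L. split; [exact HL|]. intros t Ht x. apply (series_val_lincomb L); assumption.
Qed.

Lemma good_series_val_pow_jets (a : jets) (p : nat) :
  good a -> small_time (fun t => forall x, series_val (pow_jets a p) x t = series_val a x t ^ p).
Proof.
  intros Ha. induction p as [|p IH]; simpl.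
  - exists 1. split; [lra|]. intros t _ x. unfold series_val.
    unfold PSeries. rewrite (is_series_unique _ (sum_f_R0 (fun n => one_jets n 0%nat x * t ^ n) 0)).
    + simpl. ring.
    + apply is_series_finite. intros [|i] Hi; [lia|]. simpl. ring.
  - refine (small_time_mono _ _ _ (small_time_and _ _
      (good_series_val_conv a (pow_jets a p) Ha (good_pow_jets a p Ha)) IH)).
    intros t [H1 H2] x. rewrite H1, H2. reflexivity.
Qed.

Lemma Dx_Dinv_0 (x0 : R) (f : jets) (n : nat) (x : R) :
  Dx (Dinv x0 f) n 0%nat x = f n 0%nat x - circle_int (f n 0%nat).
Proof. unfold Dx, Dinv, mean_zero_part. simpl. field. Qed.

(** The mean of the sum of f is found without integrating the series: the sum
    of the primitives is periodic, so its derivative, which is the sum of f minus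
    the series of the means, has mean zero. *)
Lemma good_primitive (x0 : R) (f : jets) :
  good f -> small_time (fun t =>
    (forall x, continuous (fun y => series_val f y t) x) /\
    circle_int (fun y => series_val f y t) = PSeries (fun n => circle_int (f n 0%nat)) t /\
    (forall x, is_derive (fun y => series_val (Dinv x0 f) y t) x
       (mean_zero_part (fun y => series_val f y t) x))).
Proof.
  intros Hf. pose proof (good_Dinv x0 f Hf) as HF.
  destruct (good_common _ _ Hf HF) as [L [HL [H1 H2]]].
  destruct Hf as [Hj [Hp _]], HF as [HJ [HP _]].
  exists L. split; [exact HL|]. intros t Ht.
  set (m := PSeries (fun n => circle_int (f n 0%nat)) t).
  assert (Hc : forall x, continuous (fun y => series_val f y t) x).
  { apply (continuous_of_derive _ (fun x => series_val (Dx f) x t)).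
    intros x. apply (series_val_derive_x L); assumption. }
  assert (Hm : ex_pseries (fun n => circle_int (f n 0%nat)) t).
  { apply CV_radius_inside, (lt_CV_radius_geom _ L L); [lra| |exact Ht].
    intros n. apply circle_int_bound; [intros; apply jet_continuous, Hj|].
    intros x. rewrite <- (pow_1 L) at 1. apply (geometric_row L f 0); assumption. }
  assert (Hd : forall x, is_derive (fun y => series_val (Dinv x0 f) y t) x (series_val f x t - m)).
  { intros x. replace (series_val f x t - m) with (series_val (Dx (Dinv x0 f)) x t).
    - apply (series_val_derive_x L); assumption.
    - unfold series_val, m. rewrite <- PSeries_minus; [|apply (geometric_ex L); assumption|exact Hm].
      apply PSeries_ext. intros n. rewrite Dx_Dinv_0. reflexivity. }
  assert (Hmean : circle_int (fun y => series_val f y t) = m).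
  { assert (H0 : circle_int (fun y => series_val f y t - m) = 0).
    { unfold circle_int.
      etransitivity; [apply (RInt_of_derive (fun y => series_val (Dinv x0 f) y t) _ 0 1 Hd)|].
      2:{ rewrite <- (Rplus_0_l 1), (series_val_periodic _ t HP 0). ring. }
      intros x. apply (continuous_minus (fun y => series_val f y t) (fun _ => m)); [apply Hc|].
      apply continuous_const. }
    rewrite circle_int_minus_const in H0 by exact Hc. lra. }
  split; [exact Hc|]. split; [exact Hmean|].
  intros x. unfold mean_zero_part. rewrite Hmean. apply Hd.
Qed.

(** By [dx_inv_unique] only the mean of the primitive has to be known.
    [good_primitive] applied to the primitive itself gives it as the series of
    the means of its coefficients, and these vanish. *)
Lemma good_dx_inv (x0 : R) (f : jets) :
  good f -> small_time (fun t => forall x,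
    dx_inv x0 (mean_zero_part (fun y => series_val f y t)) x = series_val (Dinv x0 f) x t).
Proof.
  intros Hf.
  refine (small_time_mono _ _ _ (small_time_and _ _ (good_primitive x0 f Hf)
    (good_primitive x0 (Dinv x0 f) (good_Dinv x0 f Hf)))).
  intros t [[Hc [_ Hd]] [_ [Hm _]]] x.
  apply (dx_inv_unique x0 (fun y => series_val (Dinv x0 f) y t)).
  - exact Hd.
  - intros y. apply mean_zero_part_continuous, Hc.
  - rewrite Hm. rewrite (PSeries_ext _ (fun _ => 0)); [apply PSeries_const_0|].
    intros n. apply dx_inv_mean. intros y. apply mean_zero_part_continuous, jet_continuous, Hf.
Qed.

(** The time derivative prescribed by the equation to a solution with spatial
    profile g. *)
Definition mHS_rhs (x0 : R) (p : nat) (g : R -> R) (x : R) : R :=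
  / 2 * dx_inv x0 (mean_zero_part (fun y => Derive (fun z => g z ^ p) y * Derive g y)) x
  - g x ^ p * Derive g x.

Lemma good_mHS_rhs (x0 : R) (p : nat) (a : jets) :
  good a -> small_time (fun t => forall x,
    mHS_rhs x0 p (fun y => series_val a y t) x = series_val (rhs_jets x0 p a) x t).
Proof.
  intros Ha.
  pose proof (good_pow_jets a p Ha) as HP.
  pose proof (good_source_jets p a Ha) as HS.
  pose proof (good_series_val_pow_jets a p Ha) as E1.
  pose proof (good_derive_x a Ha) as E2.
  pose proof (good_derive_x _ HP) as E3.
  pose proof (good_series_val_conv _ _ HP (good_Dx a Ha)) as E4.
  pose proof (good_series_val_conv _ _ (good_Dx _ HP) (good_Dx a Ha)) as E5.
  pose proof (good_dx_inv x0 _ HS) as E6.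
  pose proof (good_series_val_lincomb (-1) (/ 2) _ _ (good_conv _ _ HP (good_Dx a Ha)) (good_Dinv x0 _ HS)) as E7.
  refine (small_time_mono _ _ _ (small_time_and _ _ E1 (small_time_and _ _ E2 (small_time_and _ _ E3
    (small_time_and _ _ E4 (small_time_and _ _ E5 (small_time_and _ _ E6 E7))))))).
  clear. intros t (E1 & E2 & E3 & E4 & E5 & E6 & E7) x.
  assert (HD : forall y : R, Derive (fun z : R => series_val a z t) y = series_val (Dx a) y t)
    by (intros y; apply is_derive_unique, E2).
  unfold rhs_jets. rewrite E7, E4, E1, <- E6. unfold mHS_rhs. cbv beta. rewrite HD.
  replace (fun y : R => Derive (fun z : R => series_val a z t ^ p) y * Derive (fun z : R => series_val a z t) y)
    with (fun y => series_val (source_jets p a) y t).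
  - ring.
  - apply functional_extensionality. intros y. unfold source_jets. rewrite E5.
    rewrite HD. f_equal.
    symmetry. apply is_derive_unique.
    apply (is_derive_ext (fun z => series_val (pow_jets a p) z t)); [intros; apply E1|apply E3].
Qed.

(** * Expansions in two variables *)

(** Expansion at the origin in iterated form. The constant s bounds the
    coefficients and gives the polydisc. *)
Definition expansion2 (F : R -> R -> R) (s : R) (a : nat -> nat -> R) : Prop :=
  1 <= s /\ (forall i j, Rabs (a i j) <= s ^ (i + j + 1)) /\
  forall h k, s * Rabs h < 1 -> s * Rabs k < 1 ->
    F h k = PSeries (fun i => PSeries (a i) k) h.

Lemma expansion2_summable (s : R) (a : nat -> nat -> R) (h k : R) :
  1 <= s -> (forall i j, Rabs (a i j) <= s ^ (i + j + 1)) ->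
  s * Rabs h < 1 -> s * Rabs k < 1 -> summable2 (fun i j => a i j * h ^ i * k ^ j).
Proof.
  intros Hs Ha Hh Hk. pose proof (Rabs_pos h) as Hh0. pose proof (Rabs_pos k) as Hk0.
  apply (summable2_geom _ s (s * Rabs h) (s * Rabs k)); [nra|nra|].
  intros i j. rewrite !Rabs_mult, <- !RPow_abs, !Rpow_mult_distr.
  replace (s * (s ^ i * Rabs h ^ i) * (s ^ j * Rabs k ^ j))
    with (s ^ (i + j + 1) * Rabs h ^ i * Rabs k ^ j) by (rewrite !pow_add; ring).
  apply Rmult_le_compat_r; [apply pow_le, Hk0|].
  apply Rmult_le_compat_r; [apply pow_le, Hh0|]. apply Ha.
Qed.

Lemma PSeries_PSeries (a : nat -> nat -> R) (h k : R) :
  PSeries (fun i => PSeries (a i) k) h = Series (fun i => Series (fun j => a i j * h ^ i * k ^ j)).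
Proof.
  unfold PSeries. apply Series_ext. intros i. rewrite <- Series_scal_r.
  apply Series_ext. intros j. ring.
Qed.

Lemma scaled_lt_1 (s h : R) : 0 < s -> Rabs h < / s -> s * Rabs h < 1.
Proof.
  intros Hs H. apply (Rmult_lt_compat_l s) in H; [|exact Hs]. rewrite Rinv_r in H; lra.
Qed.

Lemma expansion2_analytic2 (u : R -> R -> R) (x t s : R) (a : nat -> nat -> R) :
  expansion2 (fun h k => u (x + h) (t + k)) s a -> analytic2_at u x t.
Proof.
  intros [Hs [Ha HF]]. exists a, (/ s). split; [apply Rinv_0_lt_compat; lra|].
  intros h k Hh Hk.
  apply scaled_lt_1 in Hh; [|lra]. apply scaled_lt_1 in Hk; [|lra].
  pose proof (expansion2_summable s a h k Hs Ha Hh Hk) as Hsum. split.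
  - eexists. apply (triangle_series (fun i j => Rabs (a i j * h ^ i * k ^ j))).
    destruct Hsum as [H1 H2]. split.
    + intros i. eapply ex_series_ext; [|apply H1]. intros j. simpl. rewrite Rabs_Rabsolu. reflexivity.
    + eapply ex_series_ext; [|apply H2]. intros i. simpl. apply Series_ext. intros j.
      rewrite Rabs_Rabsolu. reflexivity.
  - rewrite (HF h k Hh Hk), PSeries_PSeries.
    apply (triangle_series (fun i j => a i j * h ^ i * k ^ j)). exact Hsum.
Qed.

(** Absolute convergence at one point (rho, rho) bounds all the coefficients
    geometrically, after which the sum by total degree is the iterated sum. *)
Lemma analytic2_expansion2 (u : R -> R -> R) (x t : R) :
  analytic2_at u x t -> exists s a, expansion2 (fun h k => u (x + h) (t + k)) s a.
Proof.
  intros [a [r [Hr H]]].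
  set (rho := r / 2).
  assert (Hrho : 0 < rho < r) by (unfold rho; lra).
  assert (Hrr : Rabs rho < r) by (rewrite Rabs_pos_eq; lra).
  destruct (H rho rho Hrr Hrr) as [Habs _].
  set (T := Series (fun n => sum_f_R0 (fun i => Rabs (a i (n - i)%nat * rho ^ i * rho ^ (n - i))) n)) in *.
  assert (Hcoef : forall i j, Rabs (a i j) <= T * (/ rho) ^ (i + j)).
  { intros i j. rewrite pow_inv.
    assert (Hp : 0 < rho ^ (i + j)) by (apply pow_lt; lra).
    apply Rmult_le_reg_r with (rho ^ (i + j)); [exact Hp|].
    rewrite Rmult_assoc, Rinv_l, Rmult_1_r by lra.
    apply Rle_trans with (sum_f_R0 (fun m => Rabs (a m (i + j - m)%nat * rho ^ m * rho ^ (i + j - m))) (i + j)).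
    - replace (Rabs (a i j) * rho ^ (i + j)) with (Rabs (a i (i + j - i)%nat * rho ^ i * rho ^ (i + j - i))).
      + apply (term_le_sum (fun m => Rabs (a m (i + j - m)%nat * rho ^ m * rho ^ (i + j - m))));
          [intros; apply Rabs_pos|lia].
      + replace (i + j - i)%nat with j by lia.
        rewrite !Rabs_mult, <- !RPow_abs, (Rabs_pos_eq rho), pow_add by lra. ring.
    - apply (term_le_Series (fun n => sum_f_R0 (fun m => Rabs (a m (n - m)%nat * rho ^ m * rho ^ (n - m))) n)
               (i + j)); [|exact Habs].
      intros n. apply cond_pos_sum. intros; apply Rabs_pos. }
  set (s := Rmax 1 (Rmax T (/ rho))).
  assert (Hs1 : 1 <= s) by apply Rmax_l.
  assert (HsT : T <= s) by (eapply Rle_trans; [apply Rmax_l|apply Rmax_r]).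
  assert (Hsr : / rho <= s) by (eapply Rle_trans; [apply Rmax_r|apply Rmax_r]).
  assert (Hir : 0 < / rho) by (apply Rinv_0_lt_compat; lra).
  assert (Ha : forall i j, Rabs (a i j) <= s ^ (i + j + 1)).
  { intros i j. eapply Rle_trans; [apply Hcoef|].
    rewrite (pow_add s (i + j) 1), pow_1, Rmult_comm.
    apply Rle_trans with ((/ rho) ^ (i + j) * s).
    - apply Rmult_le_compat_l; [apply pow_le; lra|exact HsT].
    - apply Rmult_le_compat_r; [lra|]. apply pow_incr. lra. }
  exists s, a. split; [exact Hs1|]. split; [exact Ha|].
  intros h k Hh Hk.
  assert (Hsmall : forall y, s * Rabs y < 1 -> Rabs y < r).
  { intros y Hy. apply Rlt_trans with rho; [|lra].
    apply Rmult_lt_reg_l with (/ rho); [exact Hir|]. rewrite Rinv_l by lra.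
    apply Rle_lt_trans with (2 := Hy). apply Rmult_le_compat_r; [apply Rabs_pos|exact Hsr]. }
  destruct (H h k (Hsmall h Hh) (Hsmall k Hk)) as [_ Hser].
  rewrite PSeries_PSeries.
  rewrite <- (is_series_unique _ _ Hser).
  apply is_series_unique.
  apply (triangle_series (fun i j => a i j * h ^ i * k ^ j)), expansion2_summable with s; assumption.
Qed.

Lemma expansion2_row_bound (s : R) (a : nat -> nat -> R) (i : nat) (k : R) :
  1 <= s -> (forall i j, Rabs (a i j) <= s ^ (i + j + 1)) -> s * Rabs k < 1 ->
  Rabs (PSeries (a i) k) <= s / (1 - s * Rabs k) * s ^ i.
Proof.
  intros Hs Ha Hk. pose proof (Rabs_pos k) as Hk0.
  replace (s / (1 - s * Rabs k) * s ^ i) with ((s ^ (i + 1)) / (1 - s * Rabs k))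
    by (rewrite pow_add; field; lra).
  rewrite <- Series_geom_scal by nra.
  apply Series_abs_le; [|apply ex_series_geom_scal; nra].
  intros n. rewrite Rabs_mult, <- RPow_abs, Rpow_mult_distr, <- Rmult_assoc.
  apply Rmult_le_compat_r; [apply pow_le, Hk0|].
  rewrite <- pow_add. replace (i + 1 + n)%nat with (i + n + 1)%nat by lia. apply Ha.
Qed.

Lemma expansion2_radius_h (s : R) (a : nat -> nat -> R) (k : R) :
  1 <= s -> (forall i j, Rabs (a i j) <= s ^ (i + j + 1)) -> s * Rabs k < 1 ->
  Rbar_lt 0 (CV_radius (fun i => PSeries (a i) k)).
Proof.
  intros Hs Ha Hk. rewrite <- Rabs_R0.
  apply (lt_CV_radius_geom _ (s / (1 - s * Rabs k)) s); [lra| |rewrite Rabs_R0; lra].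
  intros i. apply expansion2_row_bound; assumption.
Qed.

Lemma expansion2_radius_k (s : R) (a : nat -> nat -> R) (i : nat) (k : R) :
  1 <= s -> (forall i j, Rabs (a i j) <= s ^ (i + j + 1)) -> s * Rabs k < 1 ->
  Rbar_lt (Rabs k) (CV_radius (a i)).
Proof.
  intros Hs Ha Hk.
  apply (lt_CV_radius_geom _ (s ^ (i + 1)) s); [lra| |exact Hk].
  intros j. rewrite <- pow_add. replace (i + 1 + j)%nat with (i + j + 1)%nat by lia. apply Ha.
Qed.

(** Uniqueness for power series in h at each fixed k, then in k. *)
Lemma expansion2_unique (F G : R -> R -> R) (s s' e : R) (a b : nat -> nat -> R) (i j : nat) :
  expansion2 F s a -> expansion2 G s' b -> 0 < e ->
  (forall h k, Rabs h < e -> Rabs k < e -> F h k = G h k) -> a i j = b i j.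
Proof.
  intros [Hs [Ha HF]] [Hs' [Hb HG]] He HFG.
  set (d := Rmin e (Rmin (/ s) (/ s'))).
  assert (Hd : 0 < d).
  { unfold d. repeat apply Rmin_glb_lt; try apply Rinv_0_lt_compat; lra. }
  assert (Hd1 : d <= e) by apply Rmin_l.
  assert (Hd2 : d <= / s) by (eapply Rle_trans; [apply Rmin_r|apply Rmin_l]).
  assert (Hd3 : d <= / s') by (eapply Rle_trans; [apply Rmin_r|apply Rmin_r]).
  assert (S1 : forall y, Rabs y < d -> s * Rabs y < 1) by (intros; apply scaled_lt_1; lra).
  assert (S2 : forall y, Rabs y < d -> s' * Rabs y < 1) by (intros; apply scaled_lt_1; lra).
  assert (Hrow : forall k, Rabs k < d -> PSeries (a i) k = PSeries (b i) k).
  { intros k Hk.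
    apply (PSeries_ext_recip (fun i => PSeries (a i) k) (fun i => PSeries (b i) k) i).
    - apply expansion2_radius_h with s; [exact Hs|exact Ha|apply S1, Hk].
    - apply expansion2_radius_h with s'; [exact Hs'|exact Hb|apply S2, Hk].
    - exists (mkposreal d Hd). intros h Hh. change (Rabs (h - 0) < d) in Hh.
      rewrite Rminus_0_r in Hh. rewrite <- HF, <- HG by auto. apply HFG; lra. }
  apply PSeries_ext_recip.
  - rewrite <- Rabs_R0. apply expansion2_radius_k with s; [exact Hs|exact Ha|rewrite Rabs_R0; lra].
  - rewrite <- Rabs_R0. apply expansion2_radius_k with s'; [exact Hs'|exact Hb|rewrite Rabs_R0; lra].
  - exists (mkposreal d Hd). intros k Hk. change (Rabs (k - 0) < d) in Hk.
    rewrite Rminus_0_r in Hk. apply Hrow, Hk.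
Qed.

Lemma expansion2_ext (F G : R -> R -> R) (s : R) (a : nat -> nat -> R) :
  (forall h k, F h k = G h k) -> expansion2 F s a -> expansion2 G s a.
Proof.
  intros H [Hs [Ha HF]]. split; [exact Hs|]. split; [exact Ha|].
  intros h k Hh Hk. rewrite <- H. apply HF; assumption.
Qed.

(** Each column is recentred in h separately, and [Series_swap] puts the
    recentred columns back under the sum over j. The factor 4 leaves room for z and
    for a Cauchy estimate around z. *)
Lemma expansion2_recentre (F : R -> R -> R) (s z : R) (a : nat -> nat -> R) :
  expansion2 F s a -> 4 * s * Rabs z <= 1 ->
  expansion2 (fun h k => F (z + h) k) (4 * s) (fun i j => recentre (fun i => a i j) z i).
Proof.
  intros [Hs [Ha HF]] Hz. pose proof (Rabs_pos z) as Hz0.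
  assert (Hcol : forall j i, Rabs (a i j) <= s ^ (j + 1) * s ^ i).
  { intros j i. rewrite <- pow_add. replace (j + 1 + i)%nat with (i + j + 1)%nat by lia. apply Ha. }
  set (rho := / (4 * s)).
  assert (Hrho : 0 < rho) by (apply Rinv_0_lt_compat; lra).
  assert (Hth : s * (Rabs z + rho) <= / 2).
  { unfold rho. rewrite Rmult_plus_distr_l.
    replace (s * / (4 * s)) with (/ 4) by (field; lra). lra. }
  split; [lra|]. split.
  - intros i j.
    eapply Rle_trans; [apply (recentre_bound _ (s ^ (j + 1)) s z rho i); [lra|exact Hrho|lra|apply Hcol]|].
    unfold rho at 2. rewrite Rinv_inv.
    replace (i + j + 1)%nat with ((j + 1) + i)%nat by lia. rewrite (pow_add (4 * s)).
    apply Rmult_le_compat_r; [apply pow_le; lra|].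
    set (q := s * (Rabs z + rho)) in *.
    assert (Hsj : 0 < s ^ (j + 1)) by (apply pow_lt; lra).
    apply Rle_trans with (2 * s ^ (j + 1)).
    + apply Rmult_le_reg_r with (1 - q); [lra|]. unfold Rdiv.
      rewrite Rmult_assoc, Rinv_l by lra. nra.
    + rewrite Rpow_mult_distr. apply Rmult_le_compat_r; [lra|].
      rewrite pow_add, pow_1. assert (1 <= 4 ^ j) by (apply pow_R1_Rle; lra). lra.
  - intros h k Hh Hk. pose proof (Rabs_pos h) as Hh0. pose proof (Rabs_pos k) as Hk0.
    assert (Hk1 : s * Rabs k < 1) by nra.
    assert (Hzh : s * (Rabs z + Rabs h) < 1) by nra.
    rewrite HF; [|apply Rle_lt_trans with (2 := Hzh); apply Rmult_le_compat_l; [lra|apply Rabs_triang]|exact Hk1].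
    rewrite (recentre_sum _ (s / (1 - s * Rabs k)) s z h);
      [|lra|exact Hzh|intros; apply expansion2_row_bound; assumption].
    apply PSeries_ext. intros i. unfold recentre at 1.
    rewrite (Series_ext _ (fun n => Series (fun j => binom (n + i) i * a (n + i)%nat j * z ^ n * k ^ j))).
    + rewrite Series_swap.
      * unfold PSeries. apply Series_ext. intros j. unfold recentre.
        rewrite <- Series_scal_r. reflexivity.
      * apply (summable2_geom _ (s * (/ rho) ^ i) (s * (Rabs z + rho)) (s * Rabs k)); [nra|nra|].
        intros n j. rewrite Rabs_mult, <- RPow_abs.
        eapply Rle_trans.
        -- apply Rmult_le_compat_r; [apply pow_le, Hk0|].
           apply (recentre_term_bound (fun i => a i j) (s ^ (j + 1)) s z rho n i);
             [lra|exact Hrho|lra|apply Hcol].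
        -- rewrite (Rpow_mult_distr s (Rabs k)), pow_add, pow_1. right. ring.
    + intros n. unfold PSeries.
      rewrite (Rmult_comm (binom (n + i) i)), Rmult_assoc, <- Series_scal_r.
      apply Series_ext. intros j. ring.
Qed.

(** [series_val_expand] gives the expansion in h at every time t + k, and the
    coefficient of each order in h is then recentred at t. *)
Lemma series_val_expansion2 (L : R) (a : jets) (x t : R) :
  1 <= L -> jet a -> geometric L a -> L * Rabs t < 1 ->
  exists s b, expansion2 (fun h k => series_val a (x + h) (t + k)) s b.
Proof.
  intros HL Hj Ha Ht. pose proof (Rabs_pos t) as Ht0.
  set (rho := (/ L - Rabs t) / 2).
  assert (Htl : Rabs t < / L).
  { apply Rmult_lt_reg_l with L; [lra|]. rewrite Rinv_r; lra. }
  assert (Hrho : 0 < rho) by (unfold rho; lra).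
  assert (Hth : L * (Rabs t + rho) < 1).
  { unfold rho. replace (L * (Rabs t + (/ L - Rabs t) / 2)) with ((L * Rabs t + 1) / 2)
      by (field; lra). lra. }
  set (q := L * (Rabs t + rho)) in *.
  assert (Hq0 : 0 <= q) by (unfold q; apply Rmult_le_pos; lra).
  set (s := 2 * L + / rho + / (1 - q)).
  assert (Hir : 0 < / rho) by (apply Rinv_0_lt_compat, Hrho).
  assert (Hiq : 0 < / (1 - q)) by (apply Rinv_0_lt_compat; lra).
  (* One factor s is for the geometric rates in h and k, the other absorbs
     the constant 1 / (1 - q) of the recentred series. *)
  exists (s * s), (fun i j => recentre (fun n => a n i x) t j).
  assert (Hs : 1 <= s) by (unfold s; lra).
  assert (HP : forall m, 0 < L ^ m) by (intros; apply pow_lt; lra).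
  split; [nra|]. split.
  - intros i j.
    eapply Rle_trans; [apply (recentre_bound _ (L ^ (i + 1)) L t rho j);
      [lra|exact Hrho|exact Hth|intros n; apply geometric_row, Ha]|].
    fold q. unfold Rdiv. rewrite Rpow_mult_distr.
    replace (i + j + 1)%nat with ((i + 1) + j)%nat by lia. rewrite !(pow_add s (i + 1) j).
    replace (s ^ (i + 1) * s ^ j * (s ^ (i + 1) * s ^ j))
      with ((s ^ (i + 1) * s ^ (i + 1)) * s ^ j * s ^ j) by ring.
    assert (H1 : L ^ (i + 1) <= s ^ (i + 1)) by (apply pow_incr; unfold s; lra).
    assert (H2 : / (1 - q) <= s ^ (i + 1)).
    { apply Rle_trans with s; [unfold s; lra|]. rewrite <- (pow_1 s) at 1. apply Rle_pow; [lra|lia]. }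
    assert (H3 : (/ rho) ^ j <= s ^ j) by (apply pow_incr; unfold s; lra).
    assert (H4 : 1 <= s ^ j) by (apply pow_R1_Rle; lra).
    assert (H5 : 0 <= (/ rho) ^ j) by (apply pow_le; lra).
    pose proof (HP (i + 1)%nat) as H6.
    assert (H7 : L ^ (i + 1) * / (1 - q) * (/ rho) ^ j <= s ^ (i + 1) * s ^ (i + 1) * s ^ j).
    { apply Rmult_le_compat; try assumption.
      - apply Rmult_le_pos; lra.
      - apply Rmult_le_compat; lra. }
    assert (H8 : 0 <= s ^ (i + 1) * s ^ (i + 1) * s ^ j)
      by (repeat apply Rmult_le_pos; apply pow_le; lra).
    nra.
  - intros h k Hh Hk. pose proof (Rabs_pos h) as Hh0. pose proof (Rabs_pos k) as Hk0.
    assert (Hk1 : / rho * Rabs k < 1).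
    { apply Rle_lt_trans with (2 := Hk). apply Rmult_le_compat_r; [exact Hk0|].
      apply Rle_trans with s; [unfold s; lra|nra]. }
    assert (Hh1 : 2 * L * Rabs h < 1).
    { apply Rle_lt_trans with (2 := Hh). apply Rmult_le_compat_r; [exact Hh0|].
      apply Rle_trans with s; [unfold s; lra|nra]. }
    assert (Hkr : Rabs k < rho).
    { apply Rmult_lt_reg_l with (/ rho); [exact Hir|]. rewrite Rinv_l; lra. }
    assert (Htk : L * (Rabs t + Rabs k) < 1).
    { apply Rle_lt_trans with (2 := Hth). unfold q. apply Rmult_le_compat_l; lra. }
    rewrite (series_val_expand L); try assumption.
    + apply PSeries_ext. intros i.
      apply (recentre_sum _ (L ^ (i + 1)) L); [lra|exact Htk|intros n; apply geometric_row, Ha].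
    + apply Rle_lt_trans with (2 := Htk). apply Rmult_le_compat_l; [lra|apply Rabs_triang].
Qed.

Lemma good_analytic2 (a : jets) :
  good a -> small_time (fun t => forall x, analytic2_at (series_val a) x t).
Proof.
  intros [Hj [_ [L [HL Ha]]]]. exists L. split; [exact HL|]. intros t Ht x.
  destruct (series_val_expansion2 L a x t HL Hj Ha Ht) as [s [b Hb]].
  exact (expansion2_analytic2 _ _ _ _ _ Hb).
Qed.

(** * Jets of a jointly analytic function *)

Lemma binom_diag (n : nat) : binom n n = 1.
Proof. induction n as [|n IH]; [reflexivity|]. simpl. rewrite IH, binom_over by lia. ring. Qed.

Lemma binom_subdiag (k : nat) : binom (1 + k) k = INR (S k).
Proof.
  pose proof (binom_absorb_up 0 k) as H. change (0 + k)%nat with k in H.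
  rewrite binom_diag, Rmult_1_r in H. rewrite <- H. change (INR 1) with 1. ring.
Qed.

(** Compactness of the interval. Since Q is monotone in the single number d,
    the Lebesgue number of the covering is itself a uniform choice. *)
Lemma uniform_on_interval (Q : R -> R -> Prop) :
  (forall y d d', 0 < d' <= d -> Q y d -> Q y d') ->
  (forall x, exists d, 0 < d /\ forall y, Rabs (y - x) < d -> Q y d) ->
  exists d, 0 < d /\ forall y, 0 <= y <= 1 -> Q y d.
Proof.
  intros Hmono Hloc.
  set (f := fun x => proj1_sig (constructive_indefinite_description _ (Hloc x))).
  assert (Hf : forall x, 0 < f x /\ forall y, Rabs (y - x) < f x -> Q y (f x)).
  { intros x. unfold f. apply proj2_sig. }
  destruct (compactness_value_1d 0 1 (fun x => mkposreal (f x) (proj1 (Hf x)))) as [d Hd].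
  exists d. split; [apply cond_pos|]. intros y Hy.
  apply NNPP. intros Hn. apply (Hd y Hy). intros [t [_ [H1 H2]]]. simpl in H1, H2.
  apply Hn. apply (Hmono y (f t)); [split; [apply cond_pos|exact H2]|].
  apply (proj2 (Hf t)), H1.
Qed.

(** Recentring the double series at (x, 0) gives the one at (x + z, 0), so the
    coefficients depend analytically on x, with derivatives as required of jets
    and with locally uniform bounds. Compactness of the circle makes the bounds
    uniform. *)
Lemma analytic2_jets (v : R -> R -> R) (eps : R) :
  0 < eps -> (forall t, Rabs t < eps -> periodic1 (fun x => v x t)) ->
  (forall x, analytic2_at v x 0) ->
  exists c, good c /\ small_time (fun t => forall x, v x t = series_val c x t).
Proof.
  intros He Hper Han.
  set (P := fun x (sa : R * (nat -> nat -> R)) => expansion2 (fun h k => v (x + h) (0 + k)) (fst sa) (snd sa)).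
  assert (Hex : forall x, exists sa, P x sa).
  { intros x. destruct (analytic2_expansion2 v x 0 (Han x)) as [s [a H]]. exists (s, a). exact H. }
  set (sc := fun x => fst (proj1_sig (constructive_indefinite_description _ (Hex x)))).
  set (coef := fun x => snd (proj1_sig (constructive_indefinite_description _ (Hex x)))).
  assert (HA : forall x, expansion2 (fun h k => v (x + h) (0 + k)) (sc x) (coef x)).
  { intros x. exact (proj2_sig (constructive_indefinite_description _ (Hex x))). }
  clearbody sc coef. clear P Hex.
  assert (Hshift : forall x z, 4 * sc x * Rabs z <= 1 ->
    expansion2 (fun h k => v (x + z + h) (0 + k)) (4 * sc x) (fun i j => recentre (fun i => coef x i j) z i)).
  { intros x z Hz.
    apply (expansion2_ext (fun h k => v (x + (z + h)) (0 + k))).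
    - intros h k. f_equal. ring.
    - apply (expansion2_recentre (fun h k => v (x + h) (0 + k))); [apply HA|exact Hz]. }
  assert (Hrec : forall x z i j, 4 * sc x * Rabs z <= 1 ->
    coef (x + z) i j = recentre (fun i => coef x i j) z i).
  { intros x z i j Hz.
    apply (expansion2_unique _ _ _ _ 1 _ (fun i j => recentre (fun i => coef x i j) z i) i j (HA (x + z)) (Hshift x z Hz)); [lra|].
    reflexivity. }
  assert (HApos : forall x, 1 <= sc x) by (intros x; apply HA).
  assert (Hperiod : forall x i j, coef (x + 1) i j = coef x i j).
  { intros x i j. apply (expansion2_unique _ _ _ _ eps _ _ i j (HA (x + 1)) (HA x) He).
    intros h k _ Hk. replace (x + 1 + h) with (x + h + 1) by ring.
    apply (Hper (0 + k)). rewrite Rplus_0_l. exact Hk. }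
  set (Q := fun y d => (forall i j, Rabs (coef y i j) <= (/ d) ^ (i + j + 1)) /\
                       (forall t, Rabs t < d -> v y t = PSeries (coef y 0%nat) t)).
  destruct (uniform_on_interval Q) as [d [Hd HQ]].
  { intros y d d' Hdd [H1 H2]. split.
    - intros i j. eapply Rle_trans; [apply H1|]. apply pow_incr. split.
      + left. apply Rinv_0_lt_compat. lra.
      + apply Rinv_le_contravar; lra.
    - intros t Ht. apply H2. lra. }
  { intros x. exists (/ (4 * sc x)). specialize (HApos x).
    split; [apply Rinv_0_lt_compat; lra|]. intros y Hy.
    replace y with (x + (y - x)) by ring. set (z := y - x) in *.
    assert (Hz : 4 * sc x * Rabs z <= 1) by (left; apply scaled_lt_1; lra).
    destruct (Hshift x z Hz) as [_ [Hb HF]]. split.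
    - intros i j. rewrite Hrec by exact Hz. rewrite Rinv_inv. apply Hb.
    - intros t Ht. specialize (HF 0 t). rewrite Rplus_0_r, Rplus_0_l in HF.
      rewrite HF; [|rewrite Rabs_R0; lra|apply scaled_lt_1; lra].
      rewrite PSeries_0. apply PSeries_ext. intros j. symmetry. apply Hrec, Hz. }
  set (L := Rmax 1 (Rmax (/ d) (/ eps))).
  assert (HL1 : 1 <= L) by apply Rmax_l.
  assert (HLd : / d <= L) by (eapply Rle_trans; [apply Rmax_l|apply Rmax_r]).
  assert (HLe : / eps <= L) by (eapply Rle_trans; [apply Rmax_r|apply Rmax_r]).
  assert (Hid : 0 < / d) by (apply Rinv_0_lt_compat, Hd).
  set (c := (fun n k x => coef x k n) : jets).
  assert (Hcp : periodic_jets c) by (intros n k x; apply Hperiod).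
  exists c. split; [split; [|split]|].
  - intros n k x. unfold c.
    set (b := fun i => binom (i + k) k * coef x (i + k)%nat n).
    replace (INR (S k) * coef x (S k) n) with (b 1%nat).
    + apply (is_derive_of_expansion (fun y => coef y k n) b x (/ (4 * sc x))).
      * apply Rinv_0_lt_compat. specialize (HApos x). lra.
      * destruct (HA x) as [Hs [Ha _]].
        apply Rbar_lt_le_trans with (/ (2 * sc x)); [apply Rinv_0_lt_compat; lra|].
        apply (CV_radius_geom b (2 ^ k * sc x ^ (k + n + 1)) (2 * sc x)); [lra|].
        intros i. unfold b. rewrite Rabs_mult, Rabs_pos_eq by apply binom_nonneg.
        apply Rle_trans with (2 ^ (i + k) * sc x ^ (i + k + n + 1)).
        -- apply Rmult_le_compat; [apply binom_nonneg|apply Rabs_pos|apply binom_le_pow|apply Ha].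
        -- rewrite Rpow_mult_distr. replace (i + k + n + 1)%nat with (i + (k + n + 1))%nat by lia.
           rewrite !(pow_add _ i). right. ring.
      * intros h Hh. rewrite Hrec; [reflexivity|]. left. apply scaled_lt_1; [|exact Hh].
        specialize (HApos x). lra.
    + unfold b. rewrite binom_subdiag. reflexivity.
  - exact Hcp.
  - exists L. split; [exact HL1|]. intros n k x.
    destruct (circle_representative x) as [y [Hy [z ->]]].
    rewrite (periodic1_IZR (c n k) y z (Hcp n k)). unfold c.
    eapply Rle_trans; [apply (HQ y Hy)|].
    replace (n + k + 1)%nat with (k + n + 1)%nat by lia. apply pow_incr. lra.
  - exists L. split; [exact HL1|]. intros t Ht x.
    assert (Hsm : forall e, 0 < e -> / e <= L -> Rabs t < e).
    { intros e He' Hle. apply Rmult_lt_reg_l with (/ e); [apply Rinv_0_lt_compat, He'|].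
      rewrite Rinv_l by lra. apply Rle_lt_trans with (2 := Ht).
      apply Rmult_le_compat_r; [apply Rabs_pos|exact Hle]. }
    destruct (circle_representative x) as [y [Hy [z ->]]].
    rewrite (periodic1_IZR (fun x => v x t)) by (apply Hper, Hsm; assumption).
    rewrite (periodic1_IZR (fun x => series_val c x t)) by (apply series_val_periodic, Hcp).
    apply (HQ y Hy). apply Hsm; assumption.
Qed.

(** * The recursion in powers of time *)

Definition agree (N : nat) (a b : jets) : Prop :=
  forall i, (i <= N)%nat -> forall k x, a i k x = b i k x.

Lemma agree_conv (N : nat) (a a' b b' : jets) :
  agree N a a' -> agree N b b' -> agree N (conv a b) (conv a' b').
Proof.
  intros Ha Hb n Hn k x. unfold conv. apply sum_eq. intros i Hi. apply sum_eq. intros j Hj.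
  rewrite Ha, Hb by lia. reflexivity.
Qed.

Lemma agree_Dx (N : nat) (a b : jets) : agree N a b -> agree N (Dx a) (Dx b).
Proof. intros H n Hn k x. unfold Dx. rewrite H by exact Hn. reflexivity. Qed.

Lemma agree_pow_jets (N p : nat) (a b : jets) : agree N a b -> agree N (pow_jets a p) (pow_jets b p).
Proof.
  intros H. induction p as [|p IH]; simpl; [intros i Hi k x; reflexivity|].
  apply agree_conv; assumption.
Qed.

Lemma agree_Dinv (N : nat) (x0 : R) (a b : jets) :
  agree N a b -> agree N (Dinv x0 a) (Dinv x0 b).
Proof.
  intros H n Hn k x.
  assert (H0 : a n = b n).
  { apply functional_extensionality; intros j. apply functional_extensionality; intros y.
    apply H, Hn. }
  unfold Dinv. rewrite H0. reflexivity.
Qed.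

(** The right-hand side at order n involves the orders up to n only, although
    it is nonlocal in x. Hence the equation is a recursion in n. *)
Lemma agree_rhs_jets (N : nat) (x0 : R) (p : nat) (a b : jets) :
  agree N a b -> agree N (rhs_jets x0 p a) (rhs_jets x0 p b).
Proof.
  intros H n Hn k x.
  assert (H1 := agree_pow_jets N p a b H). assert (H2 := agree_Dx N a b H).
  unfold rhs_jets, lincomb, source_jets. f_equal; f_equal.
  - apply (agree_conv N); assumption.
  - apply (agree_Dinv N); [|exact Hn]. apply agree_conv; [apply agree_Dx|]; assumption.
Qed.

Definition recursive (x0 : R) (p : nat) (a : jets) : Prop :=
  forall n x, INR (S n) * a (S n) 0%nat x = rhs_jets x0 p a n 0%nat x.

Lemma jet_determined (a b : jets) (n : nat) :
  jet a -> jet b -> (forall x, a n 0%nat x = b n 0%nat x) -> forall k x, a n k x = b n k x.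
Proof.
  intros Ha Hb H0. induction k as [|k IH]; [exact H0|]. intros x.
  assert (H : a n k = b n k) by (apply functional_extensionality, IH).
  apply Rmult_eq_reg_l with (INR (S k)); [|apply not_0_INR; lia].
  rewrite <- (is_derive_unique _ _ _ (Ha n k x)), <- (is_derive_unique _ _ _ (Hb n k x)), H.
  reflexivity.
Qed.

Lemma recursive_unique (x0 : R) (p : nat) (a b : jets) :
  jet a -> jet b -> recursive x0 p a -> recursive x0 p b ->
  (forall x, a 0%nat 0%nat x = b 0%nat 0%nat x) -> forall N, agree N a b.
Proof.
  intros Ha Hb Ra Rb H0. induction N as [|N IH].
  - intros i Hi. replace i with 0%nat by lia. apply jet_determined; assumption.
  - intros i Hi. destruct (Nat.eq_dec i (S N)) as [->|Hne]; [|apply IH; lia].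
    apply jet_determined; [exact Ha|exact Hb|]. intros x.
    apply Rmult_eq_reg_l with (INR (S N)); [|apply not_0_INR; lia].
    rewrite Ra, Rb. apply (agree_rhs_jets N); [exact IH|lia].
Qed.

(** Picard iteration on jets. The coefficient of t^n is final from the n-th
    iterate on, see [picard_stable]. *)
Fixpoint picard (x0 : R) (p : nat) (g : nat -> R -> R) (m : nat) : jets :=
  fun n k x =>
  match n with
  | 0%nat => g k x
  | S n' => match m with
            | 0%nat => 0
            | S m' => rhs_jets x0 p (picard x0 p g m') n' k x / INR (S n')
            end
  end.

Definition picard_limit (x0 : R) (p : nat) (g : nat -> R -> R) : jets :=
  fun n k x => picard x0 p g n n k x.

Lemma picard_stable (x0 : R) (p : nat) (g : nat -> R -> R) (m : nat) :
  agree m (picard x0 p g m) (picard x0 p g (S m)).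
Proof.
  induction m as [|m IH]; intros [|n] Hn k x; try reflexivity; [lia|].
  change (rhs_jets x0 p (picard x0 p g m) n k x / INR (S n) =
          rhs_jets x0 p (picard x0 p g (S m)) n k x / INR (S n)).
  f_equal. apply (agree_rhs_jets m); [exact IH|lia].
Qed.

Lemma picard_limit_agree (x0 : R) (p : nat) (g : nat -> R -> R) (m : nat) :
  agree m (picard x0 p g m) (picard_limit x0 p g).
Proof.
  induction m as [|m IH]; intros i Hi k x.
  - replace i with 0%nat by lia. reflexivity.
  - destruct (Nat.eq_dec i (S m)) as [->|Hne]; [reflexivity|].
    rewrite <- picard_stable by lia. apply IH. lia.
Qed.

Lemma picard_limit_recursive (x0 : R) (p : nat) (g : nat -> R -> R) : recursive x0 p (picard_limit x0 p g).
Proof.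
  intros n x.
  change (picard_limit x0 p g (S n) 0%nat x) with (rhs_jets x0 p (picard x0 p g n) n 0%nat x / INR (S n)).
  rewrite (agree_rhs_jets n x0 p _ _ (picard_limit_agree x0 p g n)) by lia.
  field. apply not_0_INR. lia.
Qed.

(** Strong majorisation passes from one iterate to the next once l = 8 e, with
    e the constant of [majorized_rhs_jets]. The rate Q = 8 L makes the bound
    L^(k + 1) of the datum a strong majorisation, because (k + 1)^3 <= 8^k. *)
Lemma picard_limit_good (x0 : R) (p : nat) (g : nat -> R -> R) (L : R) :
  1 <= L -> (forall k x, is_derive (g k) x (INR (S k) * g (S k) x)) ->
  (forall k, periodic1 (g k)) -> (forall k x, Rabs (g k x) <= L ^ (k + 1)) ->
  good (picard_limit x0 p g).
Proof.
  intros HL Hd Hp Hb.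
  set (Q := 8 * L).
  destruct (majorized_rhs_jets x0 Q L p ltac:(unfold Q; lra) ltac:(lra)) as [e [He Hrhs]].
  set (l := 8 * e).
  assert (Hl : 0 <= l) by (unfold l; lra).
  assert (Hm : forall m, jet (picard x0 p g m) /\ periodic_jets (picard x0 p g m) /\
                         strongly_majorized Q l L (picard x0 p g m)).
  { assert (H0 : forall k x, Rabs (g k x) <= L * (inv_square (0 + k) / INR (S (0 + k)) * linpow Q l 0 k)).
    { intros k x. eapply Rle_trans; [apply Hb|].
      unfold linpow, inv_square. change (0 + k)%nat with k. rewrite binom_diag.
      rewrite pow_add, pow_1, Rmult_comm. apply Rmult_le_compat_l; [lra|].
      unfold Q. rewrite Rpow_mult_distr. simpl (l ^ 0).
      assert (Hy : 0 < INR (S k)) by (apply lt_0_INR; lia).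
      assert (H8 : INR (S k) ^ 3 <= 8 ^ k).
      { replace 8 with (2 ^ 3) by ring. rewrite <- pow_mult, Nat.mul_comm, pow_mult.
        apply pow_incr. split; [lra|apply INR_S_le_pow2]. }
      set (y := INR (S k)) in *.
      apply Rle_trans with ((8 ^ k * / y ^ 3) * L ^ k); [|right; field; lra].
      rewrite <- (Rmult_1_l (L ^ k)) at 1.
      apply Rmult_le_compat_r; [apply pow_le; lra|].
      assert (Hy3 : 0 < y ^ 3) by (apply pow_lt, Hy).
      apply Rmult_le_reg_r with (y ^ 3); [exact Hy3|].
      rewrite Rmult_assoc, Rinv_l by lra. lra. }
    induction m as [|m [IH1 [IH2 IH3]]].
    - split; [|split]; intros [|n] k.
      + intros x. apply Hd.
      + intros x. simpl picard. rewrite Rmult_0_r.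
        apply (is_derive_const (K := R_AbsRing) (V := R_NormedModule)).
      + apply Hp.
      + intros x. reflexivity.
      + apply H0.
      + intros x. simpl picard. rewrite Rabs_R0.
        apply Rmult_le_pos; [lra|].
        apply Rmult_le_pos; [|apply linpow_nonneg; unfold Q; lra].
        apply Rmult_le_pos; [left; apply inv_square_pos|].
        left. apply Rinv_0_lt_compat, lt_0_INR. lia.
    - assert (Hfp : jet (pow_jets (picard x0 p g m) p) /\ periodic_jets (pow_jets (picard x0 p g m) p))
        by (apply jet_periodic_pow_jets; assumption).
      destruct Hfp as [F1 F2].
      assert (Hj : jet (rhs_jets x0 p (picard x0 p g m))).
      { apply jet_lincomb; [apply jet_conv|apply jet_Dinv, jet_conv]; try apply jet_Dx; assumption. }
      assert (Hpr : periodic_jets (rhs_jets x0 p (picard x0 p g m))).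
      { apply periodic_lincomb.
        - apply periodic_conv; [|apply periodic_Dx]; assumption.
        - apply periodic_Dinv; [apply jet_conv|apply periodic_conv];
            try apply jet_Dx; try apply periodic_Dx; assumption. }
      split; [|split]; intros [|n] k.
      + intros x. apply Hd.
      + intros x.
        change (is_derive (fun y => rhs_jets x0 p (picard x0 p g m) n k y / INR (S n)) x
          (INR (S k) * (rhs_jets x0 p (picard x0 p g m) n (S k) x / INR (S n)))).
        apply (is_derive_ext (fun y => / INR (S n) * rhs_jets x0 p (picard x0 p g m) n k y)).
        { intros y. unfold Rdiv. apply Rmult_comm. }
        replace (INR (S k) * (rhs_jets x0 p (picard x0 p g m) n (S k) x / INR (S n)))
          with (/ INR (S n) * (INR (S k) * rhs_jets x0 p (picard x0 p g m) n (S k) x))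
          by (unfold Rdiv; ring).
        apply (is_derive_scal (rhs_jets x0 p (picard x0 p g m) n k) x (/ INR (S n))). apply Hj.
      + apply Hp.
      + intros x.
        change (rhs_jets x0 p (picard x0 p g m) n k (x + 1) / INR (S n) =
                rhs_jets x0 p (picard x0 p g m) n k x / INR (S n)).
        rewrite (Hpr n k x). reflexivity.
      + apply H0.
      + intros x. apply (majorized_integrate Q l L e); try assumption.
        * unfold Q; lra.
        * unfold l. nra.
        * apply (Hrhs l (picard x0 p g m)); assumption. }
  assert (Hs : strongly_majorized Q l L (picard_limit x0 p g)) by (intros n k x; apply (proj2 (proj2 (Hm n)))).
  split; [|split].
  - intros n k x. apply (proj1 (Hm n)).
  - intros n k x. apply (proj1 (proj2 (Hm n))).
  - apply (strongly_majorized_geometric Q l L); try assumption; unfold Q; lra.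
Qed.

(** * Equivalence of the equation and the recursion *)

Lemma series_val_t_radius (a : jets) (x : R) : good a -> Rbar_lt 0 (CV_radius (fun n => a n 0%nat x)).
Proof.
  intros [_ [_ [L [HL Ha]]]]. rewrite <- Rabs_R0.
  apply (geometric_radius L); [exact HL|exact Ha|rewrite Rabs_R0; lra].
Qed.

Lemma good_derive_t (a : jets) :
  good a -> small_time (fun t => forall x,
    is_derive (fun s => series_val a x s) t (PSeries (PS_derive (fun n => a n 0%nat x)) t)).
Proof.
  intros [_ [_ [L [HL Ha]]]]. exists L. split; [exact HL|]. intros t Ht x.
  apply is_derive_PSeries, (geometric_radius L); assumption.
Qed.

Lemma recursive_solves (x0 : R) (p : nat) (a : jets) :
  good a -> recursive x0 p a ->
  small_time (fun t => forall x,
    Derive (fun s => series_val a x s) t = mHS_rhs x0 p (fun y => series_val a y t) x).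
Proof.
  intros Ha Hr.
  refine (small_time_mono _ _ _ (small_time_and _ _ (good_derive_t a Ha) (good_mHS_rhs x0 p a Ha))).
  intros t [H1 H2] x. rewrite H2. etransitivity; [apply is_derive_unique, H1|].
  apply PSeries_ext. intros n. apply Hr.
Qed.

Lemma small_time_open (P : R -> Prop) :
  small_time P -> small_time (fun t => locally t P).
Proof.
  intros [L [HL HP]]. exists L. split; [exact HL|]. intros t Ht.
  assert (Hd : 0 < (1 - L * Rabs t) / L) by (apply Rdiv_lt_0_compat; lra).
  exists (mkposreal _ Hd). intros s Hs. change (Rabs (s - t) < (1 - L * Rabs t) / L) in Hs.
  apply HP.
  apply (Rmult_lt_compat_l L) in Hs; [|lra].
  replace (L * ((1 - L * Rabs t) / L)) with (1 - L * Rabs t) in Hs by (field; lra).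
  assert (Rabs s <= Rabs (s - t) + Rabs t).
  { replace s with ((s - t) + t) at 1 by ring. apply Rabs_triang. }
  nra.
Qed.

(** For each x the equation is an identity between two power series in t. *)
Lemma solves_recursive (x0 : R) (p : nat) (c : jets) :
  good c ->
  small_time (fun t => forall x,
    Derive (fun s => series_val c x s) t = mHS_rhs x0 p (fun y => series_val c y t) x) ->
  recursive x0 p c.
Proof.
  intros Hc Hs n x.
  apply (PSeries_ext_recip (PS_derive (fun n => c n 0%nat x)) (fun n => rhs_jets x0 p c n 0%nat x) n).
  - rewrite CV_radius_derive. apply series_val_t_radius, Hc.
  - apply series_val_t_radius, good_rhs_jets, Hc.
  - apply small_time_locally.
    refine (small_time_mono _ _ _ (small_time_and _ _ Hs (small_time_and _ _ (good_derive_t c Hc)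
      (good_mHS_rhs x0 p c Hc)))).
    intros t [H1 [H2 H3]]. rewrite <- (is_derive_unique _ _ _ (H2 x)).
    etransitivity; [apply H1|apply H3].
Qed.

(** * The identity theorem in time *)

Definition analytic1 (f : R -> R) (t : R) : Prop :=
  exists s b, 1 <= s /\ (forall n, Rabs (b n) <= s ^ (n + 1)) /\
    forall k, s * Rabs k < 1 -> f (t + k) = PSeries b k.

Lemma analytic1_radius (s : R) (b : nat -> R) (k : R) :
  1 <= s -> (forall n, Rabs (b n) <= s ^ (n + 1)) -> s * Rabs k < 1 ->
  Rbar_lt (Rabs k) (CV_radius b).
Proof.
  intros Hs Hb Hk. apply (lt_CV_radius_geom b s s); [lra| |exact Hk].
  intros n. eapply Rle_trans; [apply Hb|]. rewrite pow_add, pow_1. right. ring.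
Qed.

Lemma analytic1_minus (f g : R -> R) (t : R) :
  analytic1 f t -> analytic1 g t -> analytic1 (fun s => f s - g s) t.
Proof.
  intros [s [b [Hs [Hb Hf]]]] [s' [b' [Hs' [Hb' Hg]]]].
  exists (s + s'), (PS_minus b b'). split; [lra|]. split.
  - intros n. eapply Rle_trans; [apply Rabs_triang|]. unfold opp; simpl. rewrite Rabs_Ropp.
    apply Rle_trans with (s ^ (n + 1) + s' ^ (n + 1)); [apply Rplus_le_compat; auto|].
    rewrite !Nat.add_1_r. simpl.
    assert (s ^ n <= (s + s') ^ n) by (apply pow_incr; lra).
    assert (s' ^ n <= (s + s') ^ n) by (apply pow_incr; lra). nra.
  - intros k Hk. pose proof (Rabs_pos k).
    assert (H1 : s * Rabs k < 1) by nra. assert (H2 : s' * Rabs k < 1) by nra.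
    rewrite Hf, Hg by assumption. symmetry. apply PSeries_minus.
    + apply CV_radius_inside, (analytic1_radius s); assumption.
    + apply CV_radius_inside, (analytic1_radius s'); assumption.
Qed.

Lemma analytic1_reflect (f : R -> R) (t : R) :
  analytic1 f (- t) -> analytic1 (fun s => f (- s)) t.
Proof.
  intros [s [b [Hs [Hb Hf]]]]. exists s, (fun n => b n * (-1) ^ n).
  split; [exact Hs|]. split.
  - intros n. rewrite Rabs_mult, pow_1_abs, Rmult_1_r. apply Hb.
  - intros k Hk. replace (- (t + k)) with (- t + - k) by ring.
    rewrite Hf by (rewrite Rabs_Ropp; exact Hk).
    apply Series_ext. intros n. rewrite Rmult_assoc, <- Rpow_mult_distr. f_equal. f_equal. ring.
Qed.

(** Once the coefficients before n vanish, divide by k^n: the quotient is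
    continuous at 0, where its value is [b n], and vanishes on the left of 0. *)
Lemma one_sided_zero (s d : R) (b : nat -> R) :
  1 <= s -> (forall n, Rabs (b n) <= s ^ (n + 1)) -> 0 < d ->
  (forall k, - d < k < 0 -> PSeries b k = 0) -> forall n, b n = 0.
Proof.
  intros Hs Hb Hd H0 n. induction n as [n IH] using lt_wf_ind.
  set (G := PSeries (PS_decr_n b n)).
  assert (HG0 : G 0 = b n) by (unfold G; rewrite PSeries_0; unfold PS_decr_n; f_equal; lia).
  assert (HGz : forall k, - d < k < 0 -> G k = 0).
  { intros k Hk. pose proof (H0 k Hk) as H. rewrite (PSeries_decr_n_aux b n k IH) in H.
    apply Rmult_integral in H. destruct H as [H|H]; [|exact H].
    exfalso. revert H. apply pow_nonzero. lra. }
  assert (HC : continuity_pt G 0).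
  { apply PSeries_continuity.
    apply (lt_CV_radius_geom _ (s ^ (n + 1)) s); [lra| |rewrite Rabs_R0; lra].
    intros k. unfold PS_decr_n. rewrite <- pow_add.
    replace (n + 1 + k)%nat with (n + k + 1)%nat by lia. apply Hb. }
  rewrite <- HG0. apply NNPP. intros Hne.
  apply continuity_pt_locally with (eps := mkposreal _ (Rabs_pos_lt _ Hne)) in HC.
  destruct HC as [e He]. simpl in He.
  set (k := - (Rmin d e / 2)).
  assert (Hmin : 0 < Rmin d e) by (apply Rmin_glb_lt; [exact Hd|apply cond_pos]).
  pose proof (Rmin_l d e). pose proof (Rmin_r d e).
  assert (Hk : - d < k < 0) by (unfold k; lra).
  assert (Hball : ball 0 e k).
  { change (Rabs (k - 0) < e). rewrite Rminus_0_r. apply Rabs_def1; unfold k; lra. }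
  specialize (He k Hball). rewrite (HGz k Hk), Rminus_0_l, Rabs_Ropp in He. lra.
Qed.

(** Let T be the supremum of the times up to which f vanishes. The expansion
    at T vanishes on the left of T, hence identically, so f vanishes beyond T. *)
Lemma identity_right (f : R -> R) (eps d : R) :
  0 < d -> (forall t, 0 <= t < eps -> analytic1 f t) ->
  (forall t, 0 <= t < d -> f t = 0) -> forall t, 0 <= t < eps -> f t = 0.
Proof.
  intros Hd Han H0 t1 Ht1. apply NNPP. intros Hne.
  set (E := fun T => 0 <= T <= t1 /\ forall s, 0 <= s <= T -> f s = 0).
  assert (Hdt : d <= t1).
  { destruct (Rle_lt_dec d t1) as [H|H]; [exact H|]. exfalso. apply Hne, H0. lra. }
  assert (HEd : E (d / 2)) by (split; [lra|intros s Hs; apply H0; lra]).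
  destruct (completeness E) as [T [HT1 HT2]].
  { exists t1. intros T [HT _]. lra. }
  { exists (d / 2). exact HEd. }
  assert (HTd : d / 2 <= T) by (apply HT1, HEd).
  assert (HTt : T <= t1) by (apply HT2; intros z [Hz _]; lra).
  assert (Hbelow : forall s, 0 <= s < T -> f s = 0).
  { intros s Hs. apply NNPP. intros Hfs. apply (Rlt_not_le T s (proj2 Hs)). apply HT2.
    intros z [Hz1 Hz2]. destruct (Rle_lt_dec z s) as [H|H]; [exact H|].
    exfalso. apply Hfs, Hz2. lra. }
  destruct (Han T ltac:(lra)) as [s [b [Hs [Hb Hf]]]].
  assert (His : 0 < / s) by (apply Rinv_0_lt_compat; lra).
  assert (Hb0 : forall n, b n = 0).
  { apply (one_sided_zero s (Rmin T (/ s))); [exact Hs|exact Hb|apply Rmin_glb_lt; lra|].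
    intros k Hk. pose proof (Rmin_l T (/ s)). pose proof (Rmin_r T (/ s)).
    rewrite <- Hf.
    - apply Hbelow. lra.
    - apply scaled_lt_1; [lra|]. apply Rabs_def1; lra. }
  assert (Hnear : forall k, Rabs k < / s -> f (T + k) = 0).
  { intros k Hk. rewrite Hf by (apply scaled_lt_1; [lra|exact Hk]).
    rewrite (PSeries_ext b (fun _ => 0)) by exact Hb0. apply PSeries_const_0. }
  assert (Hup : forall z, 0 <= z <= T + / s / 2 -> f z = 0).
  { intros z Hz. destruct (Rlt_le_dec z T) as [H|H]; [apply Hbelow; lra|].
    replace z with (T + (z - T)) by ring. apply Hnear. apply Rabs_def1; lra. }
  destruct (Rle_lt_dec t1 (T + / s / 2)) as [H|H].
  - apply Hne, Hup. lra.
  - assert (HE : E (T + / s / 2)) by (split; [lra|exact Hup]).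
    specialize (HT1 _ HE). lra.
Qed.

Lemma identity_theorem (f g : R -> R) (eps d : R) :
  0 < d -> (forall t, Rabs t < eps -> analytic1 f t) -> (forall t, Rabs t < eps -> analytic1 g t) ->
  (forall t, Rabs t < d -> f t = g t) -> forall t, Rabs t < eps -> f t = g t.
Proof.
  intros Hd Hf Hg H0 t Ht. apply Rminus_diag_uniq.
  destruct (Rle_lt_dec 0 t) as [Hp|Hn].
  - rewrite Rabs_pos_eq in Ht by exact Hp.
    apply (identity_right (fun s => f s - g s) eps d Hd).
    + intros s Hs. apply analytic1_minus; [apply Hf|apply Hg]; rewrite Rabs_pos_eq; lra.
    + intros s Hs. rewrite H0; [ring|]. rewrite Rabs_pos_eq; lra.
    + lra.
  - rewrite Rabs_left in Ht by exact Hn.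
    rewrite <- (Ropp_involutive t).
    apply (identity_right (fun s => f (- s) - g (- s)) eps d Hd).
    + intros s Hs. apply analytic1_minus; apply analytic1_reflect; [apply Hf|apply Hg];
        rewrite Rabs_Ropp, Rabs_pos_eq; lra.
    + intros s Hs. rewrite H0; [ring|]. rewrite Rabs_Ropp, Rabs_pos_eq; lra.
    + lra.
Qed.

Lemma analytic2_analytic1 (u : R -> R -> R) (x t : R) :
  analytic2_at u x t -> analytic1 (u x) t.
Proof.
  intros H. destruct (analytic2_expansion2 u x t H) as [s [a [Hs [Ha HF]]]].
  exists s, (a 0%nat). split; [exact Hs|]. split; [exact (Ha 0%nat)|].
  intros k Hk. specialize (HF 0 k). rewrite Rplus_0_r in HF.
  rewrite HF by (rewrite ?Rabs_R0; lra). apply PSeries_0.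
Qed.

(** * Existence and uniqueness *)

Lemma analytic_at_analytic2 (f : R -> R) (x t : R) :
  analytic_at f x -> analytic2_at (fun y _ => f y) x t.
Proof.
  intros [a [r [Hr H]]].
  exists (fun i j => match j with 0%nat => a i | _ => 0 end), r. split; [exact Hr|].
  intros h k Hh _.
  assert (HS : forall (n : nat) (w : R -> R), w 0 = 0 ->
    sum_f_R0 (fun i => w (match (n - i)%nat with 0%nat => a i | _ => 0 end * h ^ i * k ^ (n - i))) n
    = w (a n * h ^ n)).
  { intros n w Hw. destruct n as [|n]; [simpl; f_equal; ring|].
    rewrite tech5, sum_eq_R0, Nat.sub_diag; [simpl; rewrite Rplus_0_l; f_equal; ring|].
    intros i Hi. replace (S n - i)%nat with (S (n - i)) by lia.
    transitivity (w 0); [f_equal; ring|exact Hw]. }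
  split.
  - apply (ex_series_ext (fun n => Rabs (a n * h ^ n))).
    + intros n. symmetry. apply (HS n Rabs Rabs_R0).
    + apply CV_disk_inside.
      set (h' := (Rabs h + r) / 2).
      assert (Hh' : Rabs h < h' < r) by (unfold h'; lra).
      apply Rbar_lt_le_trans with h'; [apply Hh'|].
      pose proof (Rabs_pos h).
      assert (Hex : ex_pseries a h').
      { eexists. apply H. rewrite Rabs_pos_eq; lra. }
      destruct (Rbar_le_lt_dec h' (CV_radius a)) as [Hle|Hlt]; [exact Hle|].
      exfalso. apply (CV_disk_outside a h').
      * rewrite Rabs_pos_eq by lra. exact Hlt.
      * apply ex_series_lim_0, ex_pseries_R, Hex.
  - apply (is_series_ext (fun n => a n * h ^ n)).
    + intros n. symmetry. apply (HS n (fun y => y) eq_refl).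
    + apply is_pseries_R, H, Hh.
Qed.

Theorem theorem3 (x0 : R) (p : nat) (hp : (0 < p)%nat) (u0 : R -> R)
    (hper : periodic1 u0) (hana : forall x : R, analytic_at u0 x) :
  exists eps : R, 0 < eps /\
    exists u : R -> R -> R,
      analytic_solution x0 p u0 eps u /\
      forall v : R -> R -> R, analytic_solution x0 p u0 eps v ->
        forall x t : R, Rabs t < eps -> v x t = u x t.
Proof.
  (* The coefficients of the datum, seen as a function of (x, t), provide the jets
     of order 0 in t with bounds uniform in x. *)
  destruct (analytic2_jets (fun x _ => u0 x) 1) as [c0 [[Hj0 [Hp0 [L0 [HL0 Hb0]]]] Hc0]];
    [lra|intros; exact hper|intros; apply analytic_at_analytic2, hana|].
  assert (Hu0 : forall x, c0 0%nat 0%nat x = u0 x).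
  { destruct Hc0 as [L [HL Hc0]]. intros x.
    rewrite (Hc0 0) by (rewrite Rabs_R0; lra). unfold series_val. symmetry. apply PSeries_0. }
  set (a := picard_limit x0 p (c0 0%nat)).
  assert (Ha : good a).
  { apply (picard_limit_good x0 p (c0 0%nat) L0 HL0).
    - intros k x. apply Hj0.
    - intros k. apply Hp0.
    - intros k x. apply (Hb0 0%nat k x). }
  assert (Hrec : recursive x0 p a) by apply picard_limit_recursive.
  assert (Hval0 : forall x, series_val a x 0 = u0 x).
  { intros x. unfold series_val. rewrite PSeries_0. apply Hu0. }
  destruct (small_time_and _ _ (recursive_solves x0 p a Ha Hrec)
    (good_analytic2 a Ha)) as [L [HL Hsol]].
  assert (Heps : forall t, Rabs t < / L -> L * Rabs t < 1) by (intros; apply scaled_lt_1; lra).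
  exists (/ L). split; [apply Rinv_0_lt_compat; lra|].
  exists (series_val a). split.
  - split; [|split; [|split]].
    + intros t _. apply series_val_periodic, Ha.
    + intros x t Ht. apply (Hsol t (Heps t Ht)).
    + intros x t Ht. rewrite (proj1 (Hsol t (Heps t Ht)) x). unfold mHS_rhs. ring.
    + exact Hval0.
  - intros v [Vper [Van [Vsol V0]]] x.
    assert (HiL : 0 < / L) by (apply Rinv_0_lt_compat; lra).
    (* The sums of these jets are known to equal v on a shorter interval only. *)
    destruct (analytic2_jets v (/ L) HiL Vper) as [c [Hc Hvc]].
    { intros y. apply Van. rewrite Rabs_R0. exact HiL. }
    assert (Hcrec : recursive x0 p c).
    { apply (solves_recursive x0 p c Hc).
      assert (HS : small_time (fun t => Rabs t < / L)).
      { exists L. split; [exact HL|]. intros t Ht.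
        apply Rmult_lt_reg_l with L; [lra|]. rewrite Rinv_r; lra. }
      refine (small_time_mono _ _ _ (small_time_and _ _ HS (small_time_and _ _ Hvc (small_time_open _ Hvc)))).
      intros t [Ht [H1 H2]] y.
      replace (fun z => series_val c z t) with (fun z => v z t)
        by (apply functional_extensionality, H1).
      (* The time derivative of v needs the equality with the series on a neighbourhood
         of t, which is why the set of small times must be open. *)
      rewrite <- (Derive_ext_loc (fun s => v y s)).
      - pose proof (Vsol y t Ht) as HV.
        change (Derive (fun s : R => v y s) t = mHS_rhs x0 p (fun z => v z t) y).
        unfold mHS_rhs. lra.
      - apply (filter_imp (fun s => forall x, v x s = series_val c x s)); [|exact H2].
        intros s Hs. apply Hs. }
    assert (Hca : forall n k y, c n k y = a n k y).
    { intros n. apply (recursive_unique x0 p c a (proj1 Hc) (proj1 Ha) Hcrec Hrec) with n; [|lia].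
      intros y. change (a 0%nat 0%nat y) with (c0 0%nat 0%nat y). rewrite Hu0, <- (V0 y).
      destruct Hvc as [L' [HL' Hvc]]. rewrite (Hvc 0) by (rewrite Rabs_R0; lra).
      unfold series_val. symmetry. apply PSeries_0. }
    destruct Hvc as [L' [HL' Hvc]].
    apply (identity_theorem (v x) (series_val a x) (/ L) (/ L')).
    + apply Rinv_0_lt_compat. lra.
    + intros t Ht. apply analytic2_analytic1, Van, Ht.
    + intros t Ht. apply analytic2_analytic1. apply (Hsol t (Heps t Ht)).
    + intros t Ht. rewrite Hvc by (apply scaled_lt_1; lra).
      unfold series_val. apply PSeries_ext. intros n. apply Hca.
Qed.
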